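(* Let $l\ge 0$ and $n\ge 1$ be integers. The set $\mathcal{K}(2l+1|n)$ of contact vector fields on $\mathbb{R}^{2l+1|n}$ is a Lie sub-superalgebra of $\mathrm{Vect}(\mathbb{R}^{2l+1|n})$. More explicitly, for all superfunctions $f,g\in C^\infty(\mathbb{R}^{2l+1|n})$, $$[X_f,X_g]=X_{\{f,g\}},\qquad \{f,g\}:=fg'-f'g-\frac12\sum_{r,s=1}^{2l+n}(-1)^{\tilde T_r\tilde f}\,\omega^{rs}\,T_r(f)\,T_s(g),$$ where $h'=\partial_z(h)$.
   Context: Superspace: $C^\infty(\mathbb{R}^{2l+1|n})=C^\infty(\mathbb{R}^{2l+1})\otimes\Lambda\mathbb{R}^n$ is the real supercommutative superalgebra of superfunctions, with even coordinates $z,x_1,\dots,x_l,y_1,\dots,y_l$ and odd coordinates $\theta_1,\dots,\theta_n$ ($\theta_i\theta_j=-\theta_j\theta_i$). A tilde denotes parity ($0$ even, $1$ odd). Vector fields are superderivations of $C^\infty(\mathbb{R}^{2l+1|n})$; they are written $X=X^z\partial_z+\sum_i(X^{x_i}\partial_{x_i}+X^{y_i}\partial_{y_i})+\sum_jX^{\theta_j}\partial_{\theta_j}$ with superfunction coefficients on the left, and form the Lie superalgebra $\mathrm{Vect}(\mathbb{R}^{2l+1|n})$ with bracket $[X,Y]=XY-(-1)^{\tilde X\tilde Y}YX$ on homogeneous elements. Here $\tilde\partial_z=\tilde\partial_{x_i}=\tilde\partial_{y_i}=0$ and $\tilde\partial_{\theta_j}=1$. Contact structure: the contact form is $\alpha=dz+\sum_{i=1}^l(x_i\,dy_i-y_i\,dx_i)+\sum_{j=1}^n\theta_j\,d\theta_j$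 (even), with evaluation (in the sign conventions used, where $\langle\partial_{\theta_j},d\theta_i\rangle=-\delta_{ij}$) $\alpha(X)=\langle X,\alpha\rangle=X^z+\sum_i(x_iX^{y_i}-y_iX^{x_i})+\sum_jX^{\theta_j}\theta_j$. $\mathrm{Tan}(\mathbb{R}^{2l+1|n})$ denotes the set of vector fields $X$ with $\alpha(X)=0$. A vector field $X$ is a contact vector field if $[X,T]\in\mathrm{Tan}(\mathbb{R}^{2l+1|n})$ for all $T\in\mathrm{Tan}(\mathbb{R}^{2l+1|n})$. The vector fields $T_r$, $1\le r\le 2l+n$: $T_r=\partial_{x_r}+y_r\partial_z$ for $1\le r\le l$; $T_r=\partial_{y_{r-l}}-x_{r-l}\partial_z$ for $l+1\le r\le 2l$; $T_r=\partial_{\theta_{r-2l}}-\theta_{r-2l}\partial_z$ for $2l+1\le r\le 2l+n$. Thus $\tilde T_r=0$ for $r\le 2l$ and $\tilde T_r=1$ for $r>2l$. The matrix $(\omega^{rs})_{1\le r,s\le 2l+n}$ is, in blocks of sizes $l,l,n$, $(\omega^{rs})=\begin{pmatrix}0&-\mathrm{id}_l&0\\ \mathrm{id}_l&0&0\\0&0&\mathrm{id}_n\end{pmatrix}$. For homogeneous $f$, $X_f=f\,\partial_z-\frac12\sum_{r,s=1}^{2l+n}(-1)^{\tilde f\tilde T_r}\omega^{rs}T_r(f)T_s$. The contact vector fields are exactly the vector fields of the form $X_f$ with $f\in C^\infty(\mathbb{R}^{2l+1|n})$. The formulas for $X_f$ and $\{f,g\}$ are for homogeneous arguments and are extended (bi)linearly.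 *)

(* Defs.v *)
From HB Require Import structures.
From mathcomp Require Import all_boot all_order all_algebra.
From mathcomp Require Import all_classical all_reals all_analysis.
(* Last, so that set0, subset, ... are those of {set T}. *)
From mathcomp Require Import fintype finset.
Set Implicit Arguments.
Unset Strict Implicit.
Unset Printing Implicit Defensive.
Import Order.TTheory GRing.Theory Num.Theory.
Import numFieldNormedType.Exports.
Local Open Scope ring_scope.

(** * The algebra C^oo(R^m) *)

Section Smooth.
Variables (R : realType) (m : nat).
Implicit Types (f g : 'rV[R]_m -> R) (i : 'I_m) (k : nat).

Definition partial i f : 'rV[R]_m -> R := fun x => 'D_(delta_mx 0 i) f x.

(* [Ck k f]: all iterated partial derivatives of [f] of order at most [k]
   exist everywhere and are continuous. *)
Fixpoint Ck k f : Prop :=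
  continuous f /\
  (if k is k'.+1 then
     forall i, (forall x, derivable f x (delta_mx 0 i)) /\ Ck k' (partial i f)
   else True).

Definition smooth : {pred 'rV[R]_m -> R} := fun f => `[< forall k, Ck k f >].

Lemma smoothP f : reflect (forall k, Ck k f) (f \in smooth).
Proof. exact: asboolP. Qed.

Lemma CkW k f : Ck k.+1 f -> Ck k f.
Proof.
elim: k f => [|k IH] f [cf /= H]; split=> // i; have [df Cf] := H i.
by split=> //; apply: IH.
Qed.

Lemma Ck_cst k (c : R) : Ck k (cst c).
Proof.
elim: k c => [|k IH] c; first by split=> //; exact: cst_continuous.
split=> [|i]; first exact: cst_continuous.
split=> [x|]; first exact: derivable_cst.
suff -> : partial i (cst c) = cst 0 by [].
by apply/funext => x; rewrite /partial derive_cst.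
Qed.

Lemma CkB k f g : Ck k f -> Ck k g -> Ck k (f - g).
Proof.
have cB f' g' : continuous f' -> continuous g' -> continuous (f' - g').
  by move=> cf cg x; exact: cvgB (cf x) (cg x).
elim: k f g => [|k IH] f g [cf Hf] [cg Hg]; first by split=> //; exact: cB.
split=> [|i]; first exact: cB.
have [df Cf] := Hf i; have [dg Cg] := Hg i.
split=> [x|]; first exact: derivableB.
suff -> : partial i (f - g) = partial i f - partial i g by exact: IH.
by apply/funext => x; rewrite /partial deriveB.
Qed.

Lemma CkD k f g : Ck k f -> Ck k g -> Ck k (f + g).
Proof.
move=> Cf Cg; have -> : f + g = f - (cst 0 - g).
  by apply/funext => x; rewrite !fctE sub0r opprK.
by apply/CkB/CkB => //; exact: Ck_cst.
Qed.

Lemma CkM k f g : Ck k f -> Ck k g -> Ck k (f * g).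
Proof.
have cM f' g' : continuous f' -> continuous g' -> continuous (f' * g').
  by move=> cf cg x; exact: cvgM (cf x) (cg x).
elim: k f g => [|k IH] f g Hf Hg; have [cf df] := Hf; have [cg dg] := Hg.
  by split=> //; exact: cM.
split=> [|i]; first exact: cM.
have [df' Cf] := df i; have [dg' Cg] := dg i.
split=> [x|]; first exact: derivableM.
suff -> : partial i (f * g) = f * partial i g + g * partial i f.
  by apply: CkD; apply: IH => //; exact: CkW.
by apply/funext => x; rewrite /partial deriveM.
Qed.

Fact smooth_subring_closed : subring_closed smooth.
Proof.
split; first by apply/smoothP => k; exact: Ck_cst.
- by move=> f g /smoothP Cf /smoothP Cg; apply/smoothP => k; exact: CkB.
- by move=> f g /smoothP Cf /smoothP Cg; apply/smoothP => k; exact: CkM.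
Qed.

HB.instance Definition _ :=
  GRing.isSubringClosed.Build ('rV[R]_m -> R) smooth smooth_subring_closed.

Fact smooth_scaler_closed : GRing.scaler_closed smooth.
Proof.
move=> a f /smoothP Cf; apply/smoothP => k.
have -> : a *: f = cst a * f by [].
by apply: CkM => //; exact: Ck_cst.
Qed.

HB.instance Definition _ :=
  GRing.isScaleClosed.Build R ('rV[R]_m -> R) smooth smooth_scaler_closed.

Record smoothfun : Type := SmoothFun {
  smoothfun_val :> 'rV[R]_m -> R;
  _ : smoothfun_val \in smooth }.

HB.instance Definition _ := [isSub of smoothfun for smoothfun_val].
HB.instance Definition _ := [Choice of smoothfun by <:].
HB.instance Definition _ := [SubChoice_isSubComNzRing of smoothfun by <:].
HB.instance Definition _ := [SubZmodule_isSubLmodule of smoothfun by <:].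

Fact smoothfun_scalerAl (a : R) (f g : smoothfun) : a *: (f * g) = a *: f * g.
Proof. by apply/val_inj/funext => x /=; exact: mulrA. Qed.
HB.instance Definition _ :=
  GRing.Lmodule_isLalgebra.Build R smoothfun smoothfun_scalerAl.
HB.instance Definition _ := GRing.Lalgebra_isComAlgebra.Build R smoothfun.

Fact partial_smooth i (f : smoothfun) : partial i f \in smooth.
Proof.
by apply/smoothP => k; have /smoothP/(_ k.+1)[_ /(_ i)[]] := valP f.
Qed.

Definition spartial i (f : smoothfun) : smoothfun :=
  SmoothFun (partial_smooth i f).

Fact coord_smooth i : (fun x : 'rV[R]_m => x 0 i) \in smooth.
Proof.
apply/smoothP => k; pose p := fun x : 'rV[R]_m => x 0 i; rewrite -/p.
have cp : continuous p by exact: coord_continuous.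
case: k => [|k]; split=> // j.
have quot x : \forall h \near 0^'%classic,
    h^-1 *: ((p \o shift x) (h *: delta_mx 0 j) - p x) = (i == j)%:R.
  near=> h; rewrite /p /= !mxE addrK eqxx /=.
  by rewrite [LHS]mulKf //; near: h; exact: nbhs_dnbhs_neq.
split=> [x|]; first exact: is_cvg_near_cst (quot x).
suff -> : partial j p = cst (i == j)%:R by exact: Ck_cst.
by apply/funext => x; apply: lim_near_cst.
Unshelve. all: by end_near. Qed.

Definition coord i : smoothfun := SmoothFun (coord_smooth i).

End Smooth.

(** * Superfunctions: C^oo(R^m) (x) Lambda(R^n) *)

Section GrassmannSign.
Variable n : nat.
Implicit Types I J K : {set 'I_n}.

(* theta_I theta_J = (-1)^(inversions I J) theta_(I :|: J) for disjoint I, J,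
   where theta_I is the product of the theta_i, i \in I, in increasing order. *)
Definition inversions I J : nat := (\sum_(i in I) \sum_(j in J) (j < i))%N.

Lemma inversions0l I : inversions set0 I = 0%N.
Proof. by rewrite /inversions big_set0. Qed.

Lemma inversions0r I : inversions I set0 = 0%N.
Proof. by rewrite /inversions big1 // => i _; rewrite big_set0. Qed.

Lemma inversionsUl I J K : [disjoint I & J] ->
  inversions (I :|: J) K = (inversions I K + inversions J K)%N.
Proof.
move=> dIJ; rewrite /inversions -bigU //.
by apply: eq_bigl => i; rewrite !inE.
Qed.

Lemma inversionsUr I J K : [disjoint J & K] ->
  inversions I (J :|: K) = (inversions I J + inversions I K)%N.
Proof.
move=> dJK; rewrite /inversions -big_split /=; apply: eq_bigr => i _.
by rewrite -bigU //; apply: eq_bigl => j; rewrite !inE.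
Qed.

End GrassmannSign.

(* [f I] is the coefficient of theta_I in f = \sum_I f_I theta_I. *)
Definition superfun (R : realType) (m n : nat) : Type :=
  {ffun {set 'I_n} -> smoothfun R m}.

Section Superfunctions.
Variables (R : realType) (m n : nat).
Local Notation superfun := (superfun R m n).
Implicit Types f g h : superfun.
Implicit Types I J K L : {set 'I_n}.

HB.instance Definition _ := Choice.on superfun.
HB.instance Definition _ := GRing.Lmodule.on superfun.

Definition supermul f g : superfun := [ffun K : {set 'I_n} =>
  \sum_(I : {set 'I_n} | I \subset K)
     (-1) ^+ inversions I (K :\: I) * (f I * g (K :\: I))].

Definition of_smooth (a : smoothfun R m) : superfun :=
  [ffun I : {set 'I_n} => if I == set0 then a else 0].

Fact supermulA : associative supermul.
Proof.
move=> f g h; apply/ffunP => K; rewrite !ffunE.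
transitivity (\sum_(I : {set 'I_n} | I \subset K)
  \sum_(J : {set 'I_n} | J \subset K :\: I)
  (-1) ^+ (inversions I (K :\: I) + inversions J (K :\: I :\: J)) *
    (f I * (g J * h (K :\: I :\: J)))).
  apply: eq_bigr => I _; rewrite ffunE !mulr_sumr; apply: eq_bigr => J _.
  by rewrite exprD -!mulrA; congr (_ * _); rewrite mulrCA.
rewrite [RHS](eq_bigr (fun L : {set 'I_n} => \sum_(I : {set 'I_n} | I \subset L)
  (-1) ^+ (inversions L (K :\: L) + inversions I (L :\: I)) *
    (f I * (g (L :\: I) * h (K :\: L))))); last first.
  move=> L _; rewrite ffunE mulr_suml mulr_sumr; apply: eq_bigr => I _.
  by rewrite exprD -!mulrA.
rewrite [RHS](exchange_big_dep (fun I => I \subset K)) /=; last first.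
  by move=> L I LK IL; exact: (subset_trans IL LK).
apply: eq_bigr => I IK.
rewrite [RHS](reindex_onto (fun J => I :|: J) (fun L => L :\: I)) /=; last first.
  by move=> L /andP[_ IL]; rewrite setDE setUIr setUCr setIT; exact/setUidPr.
apply: eq_big => J.
  rewrite subUset IK subsetUl andbT /= setDUl setDv set0U.
  rewrite subsetD; congr (_ && _).
  by apply/idP/eqP => [/setDidPl|] //; move/setDidPl.
rewrite subsetD => /andP[JK]; rewrite disjoint_sym => dIJ.
have -> : (I :|: J) :\: I = J.
  by rewrite setDUl setDv set0U; apply/setDidPl; rewrite disjoint_sym.
have -> : K :\: I :\: J = K :\: (I :|: J) by rewrite setDDl.
congr (_ ^+ _ * _).
have -> : K :\: I = J :|: (K :\: (I :|: J)).
  apply/setP => i; rewrite !inE.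
  have [iJ|] := boolP (i \in J); last by rewrite orbF.
  by rewrite (subsetP JK) // (disjointFr _ iJ) // disjoint_sym.
rewrite inversionsUl // inversionsUr; first by rewrite -addnA addnC.
by rewrite disjoints_subset; apply/subsetP => i iJ; rewrite !inE iJ orbT.
Qed.

Fact super1mul : left_id (of_smooth 1) supermul.
Proof.
move=> f; apply/ffunP => K; rewrite ffunE (bigD1 set0) ?sub0set //= big1.
  by rewrite inversions0l setD0 ffunE eqxx !mul1r addr0.
by move=> I /andP[_ /negPf I0]; rewrite ffunE I0 mul0r mulr0.
Qed.

Fact supermul1 : right_id (of_smooth 1) supermul.
Proof.
move=> f; apply/ffunP => K; rewrite ffunE (bigD1 K) //= big1.
  by rewrite setDv inversions0r ffunE eqxx mul1r mulr1 addr0.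
move=> I /andP[IK neq]; rewrite ffunE setD_eq0 ifF ?mulr0 //.
by apply/negbTE; apply: contra neq => KI; rewrite eqEsubset IK.
Qed.

Fact supermulDl : left_distributive supermul +%R.
Proof.
move=> f g h; apply/ffunP => K; rewrite !ffunE -big_split.
by apply: eq_bigr => I _; rewrite ffunE mulrDl mulrDr.
Qed.

Fact supermulDr : right_distributive supermul +%R.
Proof.
move=> f g h; apply/ffunP => K; rewrite !ffunE -big_split.
by apply: eq_bigr => I _; rewrite ffunE !mulrDr.
Qed.

Fact super1_neq0 : of_smooth 1 != 0.
Proof.
by apply/eqP => /ffunP/(_ set0)/eqP; rewrite !ffunE eqxx oner_eq0.
Qed.

HB.instance Definition _ := GRing.Zmodule_isNzRing.Build superfun
  supermulA super1mul supermul1 supermulDl supermulDr super1_neq0.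

Lemma supermulE f g K : (f * g) K = \sum_(I : {set 'I_n} | I \subset K)
  (-1) ^+ inversions I (K :\: I) * (f I * g (K :\: I)).
Proof. by rewrite [LHS]ffunE. Qed.

Fact super_scalerAl (a : R) f g : a *: (f * g) = a *: f * g.
Proof.
apply/ffunP => K; rewrite !ffunE scaler_sumr; apply: eq_bigr => I _.
by rewrite ffunE -scalerAl -scalerAr.
Qed.
HB.instance Definition _ :=
  GRing.Lmodule_isLalgebra.Build R superfun super_scalerAl.

Fact super_scalerAr (a : R) f g : a *: (f * g) = f * (a *: g).
Proof.
apply/ffunP => K; rewrite !ffunE scaler_sumr; apply: eq_bigr => I _.
by rewrite ffunE -!scalerAr.
Qed.
HB.instance Definition _ :=
  GRing.Lalgebra_isAlgebra.Build R superfun super_scalerAr.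

Definition theta (j : 'I_n) : superfun :=
  [ffun I : {set 'I_n} => (I == [set j])%:R].

(* Component of [f] of parity [p] ([false] is even, [true] is odd). *)
Definition parity_part (p : bool) f : superfun :=
  [ffun I : {set 'I_n} => if odd #|I| == p then f I else 0].

Definition homogeneous (p : bool) f : Prop := parity_part p f = f.

Definition d_even (i : 'I_m) f : superfun :=
  [ffun I : {set 'I_n} => spartial i (f I)].

(* Left derivative: theta_j theta_I |-> theta_I for j \notin I. *)
Definition d_odd (j : 'I_n) f : superfun := [ffun I : {set 'I_n} =>
  if j \in I then 0 else (-1) ^+ inversions [set j] I * f (j |: I)].

(** ** Superderivations *)

Implicit Types X Y : superfun -> superfun.

Definition op_part (p : bool) X : superfun -> superfun :=
  fun f => \sum_(q : bool) parity_part (p (+) q) (X (parity_part q f)).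

Definition superderivation X : Prop :=
  linear X /\
  forall (p q : bool) f g, homogeneous q f ->
    op_part p X (f * g) =
    op_part p X f * g + (-1) ^+ (p && q) * (f * op_part p X g).

Definition superbracket X Y : superfun -> superfun :=
  fun f => \sum_(p : bool) \sum_(q : bool)
    (op_part p X (op_part q Y f)
     - (-1) ^+ (p && q) * op_part q Y (op_part p X f)).

Definition Vect : set (superfun -> superfun) :=
  [set X | superderivation X]%classic.

Definition lie_subsuperalgebra (K : set (superfun -> superfun)) : Prop :=
  [/\ (K `<=` Vect)%classic,
      K 0,
      forall (a : R) X Y, K X -> K Y -> K (a *: X + Y),
      forall p X, K X -> K (op_part p X)
    & forall X Y, K X -> K Y -> K (superbracket X Y)].

End Superfunctions.

(** * The contact structure on R^(2l+1|n) *)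

Section Contact.
Variables (R : realType) (l n : nat).
Local Notation m := (1 + (l + l))%N.
Local Notation superfun := (superfun R m n).
Implicit Types f g h : superfun.
Implicit Types X T : superfun -> superfun.

Definition iz : 'I_m := lshift (l + l) 0.
Definition ix (i : 'I_l) : 'I_m := rshift 1 (lshift l i).
Definition iy (i : 'I_l) : 'I_m := rshift 1 (rshift l i).

Definition zvar : superfun := of_smooth n (coord R iz).
Definition xvar (i : 'I_l) : superfun := of_smooth n (coord R (ix i)).
Definition yvar (i : 'I_l) : superfun := of_smooth n (coord R (iy i)).

Definition dz f : superfun := d_even iz f.
Definition dx (i : 'I_l) f : superfun := d_even (ix i) f.
Definition dy (i : 'I_l) f : superfun := d_even (iy i) f.

(* The coefficients of a vector field are its values on the coordinates:
   X^z = X(z), X^{x_i} = X(x_i), X^{y_i} = X(y_i), X^{theta_j} = X(theta_j). *)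
Definition alpha X : superfun :=
  X zvar + \sum_(i < l) (xvar i * X (yvar i) - yvar i * X (xvar i))
  + \sum_(j < n) X (theta R m j) * theta R m j.

Definition Tan : set (superfun -> superfun) :=
  [set X | Vect X /\ alpha X = 0]%classic.

Definition contact : set (superfun -> superfun) :=
  [set X | Vect X /\ forall T, Tan T -> Tan (superbracket X T)]%classic.

Definition Tfield (r : 'I_(l + l + n)) : superfun -> superfun :=
  match split r with
  | inl s =>
    match split s with
    | inl i => fun f => dx i f + yvar i * dz f
    | inr i => fun f => dy i f - xvar i * dz f
    end
  | inr j => fun f => d_odd j f - theta R m j * dz f
  end.

Definition Tparity (r : 'I_(l + l + n)) : bool := (l + l <= r)%N.

Definition omega : 'M[R]_(l + l + n) :=
  block_mx (block_mx 0 (- 1%:M) 1%:M 0) 0 0 1%:M.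

(* X_f and {f, g} when [f] is homogeneous of parity [p]. *)
Definition hamiltonian_hom (p : bool) f : superfun -> superfun := fun h =>
  f * dz h - 2^-1 *: \sum_(r < l + l + n) \sum_(s < l + l + n)
    ((-1) ^+ (p && Tparity r) * omega r s) *: (Tfield r f * Tfield s h).

Definition poisson_hom (p : bool) f g : superfun :=
  f * dz g - dz f * g - 2^-1 *: \sum_(r < l + l + n) \sum_(s < l + l + n)
    ((-1) ^+ (Tparity r && p) * omega r s) *: (Tfield r f * Tfield s g).

Definition hamiltonian f : superfun -> superfun :=
  fun h => \sum_(p : bool) hamiltonian_hom p (parity_part p f) h.

Definition poisson f g : superfun :=
  \sum_(p : bool) poisson_hom p (parity_part p f) g.

End Contact.

(* Main.v *)
Require Import Defs.
From HB Require Import structures.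
From mathcomp Require Import all_boot all_order all_algebra.
From mathcomp Require Import all_classical all_reals all_analysis.
From mathcomp Require Import fintype finset.
From mathcomp Require Import ring.
Set Implicit Arguments.
Unset Strict Implicit.
Unset Printing Implicit Defensive.
Import Order.TTheory GRing.Theory Num.Theory.
Import numFieldNormedType.Exports.
Local Open Scope ring_scope.

(* Contact fields are those whose bracket preserves the kernel of alpha, so they
   form a Lie superalgebra by the Jacobi identity, one parity at a time.

   The bracket formula is an identity of differential operators. Since
   [T_r, T_s] = 2 (-1)^(T_r) omega^rs dz and omega is orthogonal, writing
   X_f = f dz + sum_s a_s T_s one finds that [T_r, X_f] = sum_u T_r(a_u) T_u has no
   dz-component. Expanding X_f (X_g h) with X_f a superderivation then gives
   [X_f, X_g] = (X_f(g) - f' g) dz + sum_u (X_f(b_u) - (-1)^(f g) X_g(a_u)) T_u,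
   where b_u are the coefficients of X_g, and {f, g} = X_f(g) - f' g. The same
   commutators identify the coefficients of the T_u with those of X_{f, g}. *)

(** * Symmetry of second derivatives *)

(** The two assertions are independent: closure of the contact fields never uses the form [X_f], and
    the bracket formula never evaluates [alpha]. In both, the fields and superfunctions are
    arbitrary while every sign rule concerns homogeneous ones, so each assertion is reduced to
    parity components, with parities as explicit booleans and signs as real scalars.

    The factor 1/2 in X_f is forced: moving T_r past sum_s a_s T_s produces the dz-coefficient 2
    sum_s ± omega^rs a_s, which has to cancel the T_r(f) coming from f dz; orthogonality of omega
    solves this system for the a_s.

    In the comparison of T_u-coefficients, second derivatives of f occur both as T_r T_v f and as
    T_v T_r f. Only their commutator, a multiple of f', survives, and orthogonality collapses it to
    f' b_u, which is cancelled by the derivative of -f' g.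

    All commutators rest on the symmetry of second partial derivatives. [Ck] only asks that iterated
    partials exist and are continuous, in every order, so symmetry is derived from these continuity
    conditions. *)

Section Schwarz.
Variables (R : realType) (V : normedModType R).
Implicit Types (f : V -> R) (v w x : V).

Lemma is_derive_line f v x : (forall y, derivable f y v) ->
  forall t : R, is_derive t 1 (fun t => f (x + t *: v)) ('D_v f (x + t *: v)).
Proof.
move=> df t; pose q h := h^-1 *: ((f \o shift (x + t *: v)) (h *: v) - f (x + t *: v)).
have E : (fun h : R => h^-1 *: (((fun t => f (x + t *: v)) \o shift t) (h *: 1)
    - f (x + t *: v))) = q.
  apply/funext => h; rewrite /q /= /shift /=.
  by rewrite [h *: 1]mulr1 scalerDl addrCA.
split; first by rewrite /derivable E; exact: df.
by rewrite /derive E.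
Qed.

Lemma mvt_line f v x (h : R) : 0 < h -> (forall y, derivable f y v) ->
  exists2 c, 0 < c < h & f (x + h *: v) - f x = h * 'D_v f (x + c *: v).
Proof.
move=> h0 df; have D := is_derive_line x df.
have [|c] := MVT (f := fun t => f (x + t *: v))
  (df := fun t => 'D_v f (x + t *: v)) h0.
  apply: derivable_within_continuous => t _; exact: (@ex_derive _ _ _ _ _ _ _ (D t)).
rewrite in_itv /= scale0r addr0 subr0 => ch ->; exists c => //; exact: mulrC.
Qed.

(** The second difference is the increment along [v] of y |-> f(y + h w) - f(y). The mean value
    theorem along [v], then along [w], turns it into h^2 times one mixed derivative at a nearby
    point. *)
Lemma mvt_square f v w x (h : R) : 0 < h ->
  (forall y, derivable f y v) -> (forall y, derivable ('D_v f) y w) ->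
  exists c d, [/\ 0 < c < h, 0 < d < h &
    f (x + h *: v + h *: w) - f (x + h *: v) - (f (x + h *: w) - f x)
    = h * (h * 'D_w ('D_v f) (x + c *: v + d *: w))].
Proof.
move=> h0 df ddf.
have shiftE y : (fun k : R => k^-1 *: (((fun y => f (y + h *: w)) \o shift y) (k *: v)
    - f (y + h *: w))) = (fun k : R => k^-1 *: ((f \o shift (y + h *: w)) (k *: v)
    - f (y + h *: w))).
  by apply/funext => k /=; rewrite addrA.
have dS y : derivable (fun y => f (y + h *: w)) y v.
  by rewrite /derivable shiftE; exact: df.
have DS y : 'D_v (fun y => f (y + h *: w)) y = 'D_v f (y + h *: w).
  by rewrite /derive shiftE.
have dg y : derivable ((fun y => f (y + h *: w)) - f) y v by exact: derivableB.
have [c ch] := mvt_line x h0 dg.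
rewrite deriveB // DS.
have [d dh ->] := mvt_line (x + c *: v) h0 ddf.
rewrite !fctE => E; exists c, d; split=> //; rewrite -E.
Qed.

Lemma derive_comm f v w x :
  (forall y, derivable f y v) -> (forall y, derivable f y w) ->
  (forall y, derivable ('D_v f) y w) -> (forall y, derivable ('D_w f) y v) ->
  continuous ('D_w ('D_v f)) -> continuous ('D_v ('D_w f)) ->
  'D_w ('D_v f) x = 'D_v ('D_w f) x.
Proof.
move=> dv dw dvw dwv cvw cwv; apply/eqP; rewrite -subr_eq0 -normr_le0.
apply/ler_addgt0Pr => e e0; rewrite add0r.
have e2 : 0 < e / 2 by rewrite divr_gt0.
have /cvgrPdist_le/(_ _ e2)/nbhs_ballP[r1 r10 B1] := cvw x.
have /cvgrPdist_le/(_ _ e2)/nbhs_ballP[r2 r20 B2] := cwv x.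
(* The summand 1 keeps [M] positive when both vectors vanish, and makes the distance to [x] strictly
   less than [h * M]. *)
pose M := `|v| + `|w| + 1.
have M0 : 0 < M by rewrite ltr_wpDl // addr_ge0.
have [h h0 hM] : exists2 h, 0 < h & h * M = Num.min r1 r2.
  exists (Num.min r1 r2 / M); last by rewrite divfK // gt_eqF.
  by rewrite divr_gt0 // lt_min; apply/andP.
have hM1 : h * M <= r1 by rewrite hM ge_min lexx.
have hM2 : h * M <= r2 by rewrite hM ge_min lexx orbT.
have EM' : `|w| + `|v| + 1 = M by rewrite /M (addrC `|w|).
have inb r a b (p q : R) : h * M <= r -> `|a| + `|b| + 1 = M -> 0 < p < h -> 0 < q < h ->
    ball x r (x + p *: a + q *: b).
  move=> hr EM /andP[p0 ph] /andP[q0 qh]; rewrite -ball_normE /ball_ /=.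
  rewrite -addrA opprD addrA subrr add0r normrN.
  apply: (le_lt_trans (ler_normD _ _)); apply: lt_le_trans hr.
  rewrite !normrZ !gtr0_norm // -EM !mulrDr mulr1 ltr_pwDr // lerD //.
  - by rewrite ler_wpM2r // ltW.
  - by rewrite ler_wpM2r // ltW.
have [c [d [ch dh E1]]] := mvt_square x h0 dv dvw.
have [c' [d' [ch' dh' E2]]] := mvt_square x h0 dw dwv.
(* Both sides, multiplied by h^2, are the same second difference, which is symmetric in [v] and
   [w]. *)
have E : 'D_w ('D_v f) (x + c *: v + d *: w) = 'D_v ('D_w f) (x + c' *: w + d' *: v).
  have hn : h != 0 by rewrite gt_eqF.
  apply: (@mulfI R h hn); apply: (@mulfI R h hn).
  rewrite -[LHS]E1 -[RHS]E2 (addrAC x (h *: w)).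
  by ring.
have /B1 /= H1 : ball x r1 (x + c *: v + d *: w).
  exact: (inb _ _ _ _ _ hM1 erefl ch dh).
have /B2 /= H2 : ball x r2 (x + c' *: w + d' *: v).
  exact: (inb _ _ _ _ _ hM2 EM' ch' dh').
rewrite E in H1; rewrite [e]splitr.
apply: le_trans (lerD H1 H2).
rewrite [X in _ <= _ + X]distrC.
apply: le_trans (ler_normD _ _).
by rewrite addrA subrK.
Qed.

End Schwarz.

(** * Partial derivatives as commuting derivations of smooth functions *)

Section SmoothDerivations.
Variables (R : realType) (m : nat).
Implicit Types (f g : smoothfun R m) (i j : 'I_m).

Lemma smoothfun_derivable f i x : derivable f x (delta_mx 0 i).
Proof. by have /smoothP/(_ 1%N)[_ /(_ i)[]] := valP f. Qed.

Arguments smoothfun_derivable : clear implicits.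

Lemma smoothfun_continuous f : continuous f.
Proof. by have /smoothP/(_ 0%N)[] := valP f. Qed.

Lemma spartial_comm i j f : spartial i (spartial j f) = spartial j (spartial i f).
Proof.
apply/val_inj/funext => x; apply: derive_comm => [y|y|y|y||].
- exact: smoothfun_derivable.
- exact: smoothfun_derivable.
- exact: (smoothfun_derivable (spartial j f) i y).
- exact: (smoothfun_derivable (spartial i f) j y).
- exact: (smoothfun_continuous (f:=spartial i (spartial j f))).
- exact: (smoothfun_continuous (f:=spartial j (spartial i f))).
Qed.

Fact spartial_linear i : linear (@spartial R m i).
Proof.
move=> a f g; apply/val_inj/funext => x; rewrite /= /partial.
have df := smoothfun_derivable f i x; have dg := smoothfun_derivable g i x.
by rewrite deriveD ?deriveZ //; exact: derivableZ.
Qed.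

HB.instance Definition _ i :=
  GRing.isLinear.Build R (smoothfun R m) (smoothfun R m) _ (@spartial R m i)
    (spartial_linear i).

Lemma spartialM i f g : spartial i (f * g) = spartial i f * g + f * spartial i g.
Proof.
apply/val_inj/funext => x; rewrite /= /partial.
have df := smoothfun_derivable f i x; have dg := smoothfun_derivable g i x.
rewrite deriveM //.
rewrite [LHS]addrC; congr (_ + _); exact: mulrC.
Qed.

Lemma spartial_coord i j : spartial i (Defs.coord R j) = (j == i)%:R.
Proof.
apply/val_inj/funext => x; rewrite /= /partial.
have -> : \val ((j == i)%:R : smoothfun R m) = cst (j == i)%:R by case: (j == i).
rewrite /=; apply: lim_near_cst => //.
near=> h; rewrite /= !mxE addrK eqxx /=.
by rewrite [LHS]mulKf //; near: h; exact: nbhs_dnbhs_neq.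
Unshelve. all: by end_near. Qed.

Lemma spartial1 i : spartial i (1 : smoothfun R m) = 0.
Proof.
have := spartialM i (1 : smoothfun R m) 1; rewrite !mulr1 mul1r.
by rewrite -[LHS]addr0 => /addrI.
Qed.

End SmoothDerivations.

(** * Signs and parity in the superalgebra *)

Section Inversions.
Variable n : nat.
Implicit Types (I J K : {set 'I_n}) (j : 'I_n).

(** By disjointness each pair in I x J is strictly ordered one way or the other, hence is counted
    exactly once. This is the source of the sign in supercommutativity. *)
Lemma inversions_sym I J : [disjoint I & J] ->
  (inversions I J + inversions J I)%N = (#|I| * #|J|)%N.
Proof.
move=> dIJ; rewrite [X in (_ + X)%N]/inversions exchange_big -big_split /=.
rewrite -sum_nat_const; apply: eq_bigr => i iI.
rewrite -big_split -sum1_card; apply: eq_bigr => j jJ /=.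
have : i != j by apply: contraTneq jJ => <-; rewrite (disjointFr dIJ).
by rewrite -(inj_eq val_inj) /=; case: ltngtP.
Qed.

Lemma inversions_sym1 I j : j \notin I ->
  (inversions I [set j] + inversions [set j] I)%N = #|I|.
Proof.
by move=> jI; rewrite inversions_sym ?cards1 ?muln1 // disjoint_sym disjoints1.
Qed.

Lemma inversionsU1r I J j : j \notin J ->
  inversions I (j |: J) = (inversions I [set j] + inversions I J)%N.
Proof. by move=> jJ; rewrite inversionsUr // disjoints1. Qed.

Lemma inversionsU1l I J j : j \notin I ->
  inversions (j |: I) J = (inversions [set j] J + inversions I J)%N.
Proof. by move=> jI; rewrite inversionsUl // disjoints1. Qed.

(** For the odd Leibniz rule: in the coefficient of a product at [j |: K], it separates the terms
    where theta_j comes from the left factor from those where it comes from the right one. *)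
Lemma big_subsetU1 (V : nmodType) j K (F : {set 'I_n} -> V) : j \notin K ->
  \sum_(I : {set 'I_n} | I \subset j |: K) F I =
  \sum_(I : {set 'I_n} | I \subset K) (F (j |: I) + F I).
Proof.
move=> jK; rewrite (bigID (fun I : {set 'I_n} => j \in I)) big_split /=; congr (_ + _).
  rewrite (reindex_onto (fun I => j |: I) (fun I => I :\ j)) /=; last first.
    by move=> I /andP[_ jI]; rewrite setD1K.
  apply: eq_bigl => I; rewrite setU11 andbT.
  apply/andP/idP => [[IK /eqP <-]|IK].
    by apply/subsetP => i; rewrite !inE => /andP[/negPf ij /orP[/eqP/eqP|iI]];
       [rewrite ij | have := subsetP IK i; rewrite !inE iI orbT ij => /(_ isT)].
  rewrite setUS //; split=> //; apply/eqP; apply: setU1K.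
  by apply: contra jK; exact: (subsetP IK).
apply: eq_bigl => I; apply/andP/idP => [[IK jI]|IK].
  apply/subsetP => i iI; have := subsetP IK i iI; rewrite !inE => /orP[/eqP ij|//].
  by rewrite -ij iI in jI.
split; first exact: (subset_trans IK (subsetUr _ _)).
by apply: contra jK; exact: (subsetP IK).
Qed.

End Inversions.

(** * Parity, supercommutativity and the Leibniz rules of coordinate derivatives *)

Section Grading.
Variables (R : realType) (m n : nat).
Local Notation superfun := (superfun R m n).
Implicit Types (f g h : superfun) (p q r : bool) (I J K : {set 'I_n}).

Fact parity_part_linear p : linear (@parity_part R m n p).
Proof.
move=> a f g; apply/ffunP => I; rewrite !ffunE.
by case: ifP => // _; rewrite scaler0 addr0.
Qed.

HB.instance Definition _ p :=
  GRing.isLinear.Build R superfun superfun _ (@parity_part R m n p)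
    (parity_part_linear p).

Lemma parity_part_comp p q f :
  parity_part p (parity_part q f) = if p == q then parity_part q f else 0.
Proof.
apply/ffunP => I; case: eqP => [->|pq]; rewrite !ffunE; first by case: (_ == _).
by case: eqP => [oI|//]; case: eqP => // oI'; case: pq; rewrite -oI -oI'.
Qed.

Lemma parity_part_sum f : f = \sum_(p : bool) parity_part p f.
Proof.
by apply/ffunP => I; rewrite big_bool !ffunE; case: odd; rewrite /= ?addr0 ?add0r.
Qed.

Lemma homogeneous_part p f : homogeneous p (parity_part p f).
Proof. by rewrite /homogeneous parity_part_comp eqxx. Qed.

Lemma homogeneousP p f :
  homogeneous p f <-> forall I, odd #|I| != p -> f I = 0.
Proof.
split=> [<- I /negPf oI|H]; first by rewrite ffunE oI.
by apply/ffunP => I; rewrite ffunE; case: ifPn => // /H ->.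
Qed.

Lemma parity_part_homogeneous p q f : homogeneous q f ->
  parity_part p f = if p == q then f else 0.
Proof. by move=> <-; rewrite parity_part_comp. Qed.

Lemma homogeneous0 p : homogeneous p (0 : superfun).
Proof. exact: raddf0. Qed.

Lemma homogeneousD p f g : homogeneous p f -> homogeneous p g ->
  homogeneous p (f + g).
Proof. by rewrite /homogeneous raddfD /= => -> ->. Qed.

Lemma homogeneousZ p (a : R) f : homogeneous p f -> homogeneous p (a *: f).
Proof. by rewrite /homogeneous linearZ /= => ->. Qed.

Lemma homogeneousN p f : homogeneous p f -> homogeneous p (- f).
Proof. by rewrite /homogeneous raddfN /= => ->. Qed.

Lemma homogeneous_sum p (T : Type) (s : seq T) (Q : pred T) (F : T -> superfun) :
  (forall i, Q i -> homogeneous p (F i)) -> homogeneous p (\sum_(i <- s | Q i) F i).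
Proof.
move=> H; elim/big_ind: _ => //; first exact: homogeneous0.
by move=> *; exact: homogeneousD.
Qed.

Lemma homogeneousM p q f g : homogeneous p f -> homogeneous q g ->
  homogeneous (p (+) q) (f * g).
Proof.
move=> /homogeneousP fp /homogeneousP gq; apply/homogeneousP => K oK.
rewrite supermulE big1 // => I IK.
have [oI|/fp ->] := eqVneq (odd #|I|) p; last by rewrite mul0r mulr0.
rewrite gq ?mulr0 //; apply: contra oK => /eqP oJ.
by rewrite -(cardsID I K) (setIidPr IK) oddD oI oJ.
Qed.

(** Signs given by multiplication with a superfunction become real scalars, which move freely
    through products and linear maps. *)
Lemma signE p f : (-1) ^+ p * f = (-1 : R) ^+ p *: f.
Proof. by rewrite mulr_sign scaler_sign. Qed.

Lemma scale_mulr (a : R) f g : (a *: f) * g = a *: (f * g).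
Proof. by rewrite scalerAl. Qed.

Lemma mul_scaler (a : R) f g : f * (a *: g) = a *: (f * g).
Proof. by rewrite scalerAr. Qed.

Lemma d_even_linear (i : 'I_m) : linear (@d_even R m n i).
Proof. by move=> a f g; apply/ffunP => I; rewrite !ffunE linearP. Qed.

Lemma d_odd_linear (j : 'I_n) : linear (@d_odd R m n j).
Proof.
move=> a f g; apply/ffunP => I; rewrite !ffunE; case: ifP => _.
  by rewrite scaler0 addr0.
by rewrite mulrDr scalerAr.
Qed.

HB.instance Definition _ i :=
  GRing.isLinear.Build R superfun superfun _ (@d_even R m n i) (d_even_linear i).
HB.instance Definition _ j :=
  GRing.isLinear.Build R superfun superfun _ (@d_odd R m n j) (d_odd_linear j).

Lemma d_even_homogeneous i p f : homogeneous p f -> homogeneous p (d_even i f).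
Proof.
move=> /homogeneousP fp; apply/homogeneousP => I /fp fI.
by rewrite ffunE fI raddf0.
Qed.

Lemma d_odd_homogeneous j p f : homogeneous p f -> homogeneous (~~ p) (d_odd j f).
Proof.
move=> /homogeneousP fp; apply/homogeneousP => I oI; rewrite ffunE.
case: ifPn => // jI; rewrite fp ?mulr0 // cardsU1 jI oddD.
by move: oI; case: (odd _); case: (p).
Qed.

Lemma d_evenM i f g : d_even i (f * g) = d_even i f * g + f * d_even i g.
Proof.
apply/ffunP => K; rewrite [LHS]ffunE [RHS]ffunE !supermulE raddf_sum -big_split.
by apply: eq_bigr => I _; rewrite raddfMsign /= spartialM !ffunE mulrDr.
Qed.

Lemma homogeneous_sign p f I : homogeneous p f ->
  (-1) ^+ p * f I = (-1) ^+ #|I| * f I.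
Proof.
move=> /homogeneousP fp; rewrite -[in RHS]signr_odd.
by have [->//|/fp ->] := eqVneq (odd #|I|) p; rewrite !mulr0.
Qed.

Lemma sign_eq (A : nzRingType) (a b : nat) : odd a = odd b ->
  (-1) ^+ a = (-1) ^+ b :> A.
Proof. by rewrite -signr_odd => ->; rewrite signr_odd. Qed.

(** Passing to complements inside [K] matches the two sums; the signs of matched terms differ by
    (-1)^(|I||J|), by [inversions_sym], and only sets of parities [p] and [q] contribute. *)
Lemma supermulC p q f g : homogeneous p f -> homogeneous q g ->
  f * g = (-1 : R) ^+ (p && q) *: (g * f).
Proof.
move=> /homogeneousP fp /homogeneousP gq; apply/ffunP => K.
rewrite [RHS]ffunE !supermulE scaler_sumr.
rewrite [RHS](reindex_onto (fun I => K :\: I) (fun I => K :\: I)) /=; last first.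
  by move=> I IK; rewrite setDDr setDv set0U; exact/setIidPr.
have IKE I : (K :\: I \subset K) && (K :\: (K :\: I) == I) = (I \subset K).
  by rewrite subsetDl setDDr setDv set0U; apply/eqP/idP => /setIidPr.
rewrite (eq_bigl _ _ IKE); apply: eq_bigr => I IK.
have -> : K :\: (K :\: I) = I by rewrite setDDr setDv set0U; exact/setIidPr.
have dIJ : [disjoint I & K :\: I] by rewrite disjoint_sym disjoints_subset subsetDr.
move: (K :\: I) dIJ => J dIJ; rewrite scaler_sign -[RHS]mulr_sign.
have [oI|/fp ->] := eqVneq (odd #|I|) p; last by rewrite mulr0 mul0r !mulr0.
have [oJ|/gq ->] := eqVneq (odd #|J|) q; last by rewrite mulr0 mul0r !mulr0.
rewrite [g J * _]mulrC [RHS]mulrA; congr (_ * _).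
rewrite -oI -oJ -oddM -inversions_sym // signr_odd -exprD; apply: sign_eq.
by rewrite !oddD -addbA addbb addbF.
Qed.

Lemma d_oddM j p f g : homogeneous p f ->
  d_odd j (f * g) = d_odd j f * g + (-1 : R) ^+ p *: (f * d_odd j g).
Proof.
move=> fp; rewrite -signE mulrA.
(* On each coefficient the parity [p] is traded for the size of the index set, so that every sign
   below is a count comparable through [inversions_sym1]. *)
have fp' I : ((-1) ^+ p * f) I = (-1) ^+ #|I| * f I.
  by rewrite -(homogeneous_sign _ fp) signE scaler_sign mulr_sign;
     case: (p) => //; rewrite ffunE.
apply/ffunP => K; rewrite ffunE [RHS]ffunE !supermulE.
(* If [j] lies in [K] the left side vanishes, and on the right both products yield f(j |: I) g(j |:
   J) with opposite signs. Otherwise theta_j comes from exactly one factor, and each choice matches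
   one term of the rule. *)
have [jK|jK] := boolP (j \in K).
  rewrite -(setD1K jK); set K' := K :\ j.
  have jK' : j \notin K' by rewrite !inE eqxx.
  rewrite !big_subsetU1 // -big_split big1 //= => I IK.
  have jI : j \notin I by apply: contra jK'; exact: (subsetP IK).
  have -> : (j |: K') :\: (j |: I) = K' :\: I.
    apply/setP => i; rewrite !inE.
    by case: eqP => [->|]; rewrite ?(negPf jK') ?andbF ?orbT //.
  have -> : (j |: K') :\: I = j |: (K' :\: I).
    by apply/setP => i; rewrite !inE; case: eqP => [->|]; rewrite ?jI.
  have jJ : j \notin K' :\: I by rewrite inE (negPf jK') andbF.
  have dIJ : [disjoint I & K' :\: I].
    by rewrite disjoint_sym disjoints_subset subsetDr.
  move: (K' :\: I) jJ dIJ => J jJ dIJ.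
  rewrite !fp' !ffunE !setU11 (negPf jI) (negPf jJ) !(mul0r, mulr0, add0r, addr0).
  rewrite (inversionsU1r _ jJ) (inversionsU1l _ jI) cardsU1 jI.
  set a := inversions I J; set b := inversions [set j] I.
  set c := inversions [set j] J.
  have S : (-1) ^+ ((c + a) + (1 + #|I|) + c) = - (-1) ^+ (inversions I [set j] + a + b)
      :> smoothfun R m.
    rewrite -[RHS]mulN1r -exprS; apply: sign_eq.
    rewrite -(inversions_sym1 jI) -/b; set d := inversions I _.
    rewrite [in RHS]/= !oddD /=.
    by case: (odd a); case: (odd b); case: (odd c); case: (odd d).
  transitivity ((-1) ^+ (inversions I [set j] + a + b) * (f (j |: I) * g (j |: J))
    + (-1) ^+ ((c + a) + (1 + #|I|) + c) * (f (j |: I) * g (j |: J))).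
    by rewrite !exprD; ring.
  by rewrite S mulNr subrr.
rewrite big_subsetU1 // mulr_sumr -big_split; apply: eq_bigr => I IK /=.
have jI : j \notin I by apply: contra jK; exact: (subsetP IK).
have -> : (j |: K) :\: (j |: I) = K :\: I.
  apply/setP => i; rewrite !inE.
  by case: eqP => [->|]; rewrite ?(negPf jK) ?andbF ?orbT //.
have -> : (j |: K) :\: I = j |: (K :\: I).
  by apply/setP => i; rewrite !inE; case: eqP => [->|]; rewrite ?jI.
have jJ : j \notin K :\: I by rewrite inE (negPf jK) andbF.
have dIJ : [disjoint I & K :\: I] by rewrite disjoint_sym disjoints_subset subsetDr.
have -> : inversions [set j] K =
    (inversions [set j] I + inversions [set j] (K :\: I))%N.
  by rewrite -inversionsUr //; congr inversions; rewrite setDE setUIr setUCr setIT;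
     apply/esym/setUidPr.
move: (K :\: I) jJ dIJ => J jJ dIJ.
rewrite !fp' !ffunE (negPf jI) (negPf jJ).
rewrite (inversionsU1r _ jJ) (inversionsU1l _ jI).
set a := inversions I J; set b := inversions [set j] I.
set c := inversions [set j] J.
have S1 : (-1) ^+ ((b + c) + (c + a)) = (-1) ^+ (a + b) :> smoothfun R m.
  by apply: sign_eq; rewrite !oddD; case: (odd a); case: (odd b); case: (odd c).
have S2 : (-1) ^+ ((b + c) + (inversions I [set j] + a)) = (-1) ^+ (a + #|I| + c)
    :> smoothfun R m.
  apply: sign_eq; rewrite -(inversions_sym1 jI) -/b; set d := inversions I _.
  by rewrite !oddD; case: (odd a); case: (odd b); case: (odd c); case: (odd d).
transitivity ((-1) ^+ ((b + c) + (c + a)) * (f (j |: I) * g J)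
  + (-1) ^+ ((b + c) + (inversions I [set j] + a)) * (f I * g (j |: J))).
  by rewrite !exprD; ring.
by rewrite S1 S2 !exprD; ring.
Qed.

End Grading.

(** * Values of the coordinate derivatives on coordinates, and their commutation *)

Section Coordinates.
Variables (R : realType) (m n : nat).
Local Notation superfun := (superfun R m n).
Implicit Types (f g h : superfun) (a : smoothfun R m) (I : {set 'I_n}).

Lemma of_smooth_homogeneous a : homogeneous false (of_smooth n a).
Proof.
apply/homogeneousP => I oI; rewrite ffunE ifF //.
by apply: contraNF oI => /eqP ->; rewrite cards0.
Qed.

Lemma theta_homogeneous (j : 'I_n) : homogeneous true (theta R m j).
Proof.
apply/homogeneousP => I oI; rewrite ffunE.
by case: (I =P [set j]) oI => [->|//]; rewrite cards1.
Qed.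

Lemma d_even_of_smooth i a : d_even i (of_smooth n a) = of_smooth n (spartial i a).
Proof. by apply/ffunP => I; rewrite !ffunE; case: ifP; rewrite ?raddf0. Qed.

Lemma of_smooth_nat (b : bool) : of_smooth n (b%:R : smoothfun R m) = b%:R.
Proof. by case: b => //; apply/ffunP => I; rewrite !ffunE if_same. Qed.

Lemma d_odd_of_smooth j a : d_odd j (of_smooth n a) = 0.
Proof.
apply/ffunP => I; rewrite !ffunE; case: ifP => // _; rewrite ifF ?mulr0 //.
by apply/negbTE/set0Pn; exists j; rewrite setU11.
Qed.

Lemma d_even_theta i j : d_even i (theta R m j) = 0 :> superfun.
Proof.
apply/ffunP => I; rewrite !ffunE; case: eqP => _; last exact: raddf0.
exact: spartial1.
Qed.

Lemma d_odd_theta i j : d_odd i (theta R m j) = (i == j)%:R :> superfun.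
Proof.
rewrite -of_smooth_nat; apply/ffunP => I; rewrite !ffunE.
have [->|I0] := eqVneq I set0.
  by rewrite inE inversions0r mul1r setU0 (inj_eq set1_inj).
case: ifPn => // iI; case: eqP => [E|_]; last by rewrite mulr0.
have := congr1 (fun A : {set 'I_n} => #|A|) E.
by rewrite cards1 cardsU1 iI => -[/cards0_eq]; move/eqP: I0.
Qed.

Lemma d_even_comm i j f : d_even i (d_even j f) = d_even j (d_even i f).
Proof. by apply/ffunP => I; rewrite !ffunE spartial_comm. Qed.

Lemma d_even_odd i j f : d_even i (d_odd j f) = d_odd j (d_even i f).
Proof.
apply/ffunP => I; rewrite !ffunE; case: ifP => _; first exact: raddf0.
by rewrite raddfMsign.
Qed.

Lemma d_odd_anticomm i j f : d_odd i (d_odd j f) = - d_odd j (d_odd i f).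
Proof.
apply/ffunP => I; rewrite !ffunE !inE.
have [->|ij] := eqVneq i j; first by rewrite !mulr0; case: ifP; rewrite oppr0.
rewrite /=; have [iI|iI] := boolP (i \in I).
  by rewrite mulr0 if_same oppr0.
have [jI|jI] := boolP (j \in I); first by rewrite mulr0 oppr0.
rewrite setUCA !mulrA -mulNr -!exprD; congr (_ * _).
rewrite -[RHS]mulN1r -exprS; apply: sign_eq.
rewrite (inversionsU1r _ iI) (inversionsU1r _ jI).
(* Exactly one of i < j and j < i holds; this single inversion is the sign of anticommutation. *)
have := @inversions_sym1 _ [set i] j; rewrite inE eq_sym ij cards1 => /(_ isT) E.
have : odd (inversions [set j] [set i]) = ~~ odd (inversions [set i] [set j]).
  by move: (congr1 odd E); rewrite oddD; case: (odd _); case: (odd _).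
rewrite /= !oddD => ->.
by do 3!case: (odd _).
Qed.

End Coordinates.

Section PointEvaluation.
Variables (R : realType) (m n : nat).
Local Notation superfun := (superfun R m n).
Implicit Types (f g h : superfun) (K : {set 'I_n}) (x : 'rV[R]_m).

Definition coef_at K x f : R := f K x.

Lemma coef_at_inj f g : (forall K x, coef_at K x f = coef_at K x g) -> f = g.
Proof. by move=> E; apply/ffunP => K; apply/val_inj/funext => x; exact: E. Qed.

Lemma coef_atD K x f g : coef_at K x (f + g) = coef_at K x f + coef_at K x g.
Proof. by rewrite /coef_at ffunE. Qed.

Lemma coef_atN K x f : coef_at K x (- f) = - coef_at K x f.
Proof. by rewrite /coef_at ffunE. Qed.

Lemma coef_atZ K x (a : R) f : coef_at K x (a *: f) = a * coef_at K x f.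
Proof. by rewrite /coef_at ffunE. Qed.

Lemma coef_at0 K x : coef_at K x 0 = 0.
Proof. by rewrite /coef_at ffunE. Qed.

End PointEvaluation.

(* ring does not apply in the noncommutative superfun: read off coefficients at
   a point, with products of superfunctions as atoms, to get an identity in R. *)
Ltac super_lin :=
  let K := fresh "K" in let x := fresh "x" in
  apply: coef_at_inj => K x; rewrite !(coef_atD, coef_atN, coef_atZ, coef_at0).

(** * Homogeneous superderivations and their brackets *)

Section Superderivations.
Variables (R : realType) (m n : nat).
Local Notation superfun := (superfun R m n).
Implicit Types (f g h : superfun) (p q r : bool) (X Y Z : superfun -> superfun).

(** Vector fields are bare functions with linearity as a proposition; replacing one by a bundled map
    makes the generic lemmas on linear maps applicable. *)
Lemma linear_fun X : linear X -> exists L : {linear superfun -> superfun}, X = L.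
Proof.
move=> lX.
by exists (HB.pack_for {linear superfun -> superfun} X (GRing.isLinear.Build _ _ _ _ _ lX)).
Qed.

Lemma linear_sumZ X (I : Type) (s : seq I) (a : I -> R) (F : I -> superfun) :
  linear X -> X (\sum_(i <- s) a i *: F i) = \sum_(i <- s) a i *: X (F i).
Proof.
move=> /linear_fun[L ->]; rewrite raddf_sum.
by apply: eq_bigr => i _; exact: linearZ.
Qed.

Lemma linear_sum X (I : Type) (s : seq I) (F : I -> superfun) :
  linear X -> X (\sum_(i <- s) F i) = \sum_(i <- s) X (F i).
Proof. by move=> /linear_fun[L ->]; exact: raddf_sum. Qed.

Lemma linear_add X f g : linear X -> X (f + g) = X f + X g.
Proof. by move=> /linear_fun[L ->]; exact: raddfD. Qed.

Lemma linear_sub X f g : linear X -> X (f - g) = X f - X g.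
Proof. by move=> /linear_fun[L ->]; exact: raddfB. Qed.

Definition graded p X := forall q f, homogeneous q f -> homogeneous (p (+) q) (X f).

Definition graded_der p X := [/\ linear X, graded p X &
  forall q f g, homogeneous q f ->
    X (f * g) = X f * g + (-1 : R) ^+ (p && q) *: (f * X g)].

Lemma op_part_linear p X : linear X -> linear (op_part p X).
Proof.
move=> /linear_fun[L ->] a f g; rewrite /op_part !big_bool /=.
by rewrite !linearP /= scalerDr addrACA.
Qed.

Lemma op_part_graded p X : linear X -> graded p (op_part p X).
Proof.
move=> /linear_fun[L ->] q f fq; rewrite /op_part big_bool /=.
rewrite !(parity_part_homogeneous _ fq).
by case: q {fq}; rewrite /= !raddf0 ?addr0 ?add0r; exact: homogeneous_part.
Qed.

Lemma op_part_of_graded p q X : linear X -> graded q X ->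
  op_part p X = if p == q then X else fun=> 0.
Proof.
move=> /linear_fun[L ->] gL; apply/funext => f; rewrite /op_part.
have E s : parity_part (p (+) s) (L (parity_part s f)) =
    if p == q then L (parity_part s f) else 0.
  rewrite (parity_part_homogeneous _ (gL _ _ (homogeneous_part s f))).
  by rewrite (inj_eq (@addIb s)).
under eq_bigr => s _ do rewrite E.
case: (p == q); last by rewrite big1.
by rewrite -raddf_sum -parity_part_sum.
Qed.

(** The working form of the definition: every parity component is homogeneous and obeys a Leibniz
    rule of its own, with a scalar sign. *)
Lemma superderivationP X :
  superderivation X <-> linear X /\ forall p, graded_der p (op_part p X).
Proof.
split=> [[lX dX]|[lX dX]]; split=> // p.
  split; [exact: op_part_linear | exact: op_part_graded |].
  by move=> q f g fq; rewrite (dX p q) // signE.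
by move=> q f g fq; have [_ _ D] := dX p; rewrite (D q) // signE.
Qed.

Lemma graded_der0 p : graded_der p (fun=> 0).
Proof.
split=> [a f g|q f _|q f g _]; first by rewrite scaler0 addr0.
  exact: homogeneous0.
by rewrite mul0r mulr0 scaler0 addr0.
Qed.

Lemma graded_derD p X Y : graded_der p X -> graded_der p Y -> graded_der p (X + Y).
Proof.
move=> [lX gX dX] [lY gY dY]; split=> [a f g|q f fq|q f g fq]; rewrite !fctE.
- by rewrite lX lY scalerDr addrACA.
- exact: homogeneousD (gX _ _ fq) (gY _ _ fq).
- by rewrite (dX q) // (dY q) // mulrDl mulrDr scalerDr addrACA.
Qed.

Lemma graded_derZ p (a : R) X : graded_der p X -> graded_der p (a *: X).
Proof.
move=> [lX gX dX]; split=> [b f g|q f fq|q f g fq]; rewrite !fctE.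
- by rewrite lX scalerDr !scalerA mulrC.
- exact: homogeneousZ (gX _ _ fq).
- by rewrite (dX q) // scalerDr -!scalerAl -scalerAr !scalerA mulrC.
Qed.

Lemma graded_der_sum p (I : Type) (s : seq I) (F : I -> superfun -> superfun) :
  (forall i, graded_der p (F i)) -> graded_der p (\sum_(i <- s) F i).
Proof.
move=> dF; elim/big_ind: _ => [||i _]; [exact: graded_der0| |exact: dF].
by move=> X Y; exact: graded_derD.
Qed.

Lemma graded_der_superderivation p X : graded_der p X -> superderivation X.
Proof.
move=> dX; have [lX gX _] := dX; apply/superderivationP; split=> // q.
rewrite (op_part_of_graded _ lX gX); case: eqP => [->//|_].
exact: graded_der0.
Qed.

Lemma graded_der_mull p q a X : homogeneous p a -> graded_der q X ->
  graded_der (p (+) q) (fun f => a * X f).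
Proof.
move=> ap [lX gX dX]; split=> [b f g|r f fr|r f g fr].
- by rewrite lX mulrDr scalerAr.
- by rewrite -addbA; exact: homogeneousM (gX _ _ fr).
- rewrite (dX r) // mulrDr mulrA -scalerAr !mulrA; congr (_ + _).
  rewrite (supermulC ap fr) -scalerAl scalerA -signr_addb; congr (_ ^+ nat_of_bool _ *: _).
  by case: p ap; case: q {gX dX}; case: r fr.
Qed.

(** The parities are arguments because a function does not determine one (zero has both).
    [superbracketE] recovers the full bracket as a sum over parity components. *)
Definition graded_bracket p q X Y : superfun -> superfun :=
  fun f => X (Y f) - (-1 : R) ^+ (p && q) *: Y (X f).

Lemma graded_der_bracket p q X Y : graded_der p X -> graded_der q Y ->
  graded_der (p (+) q) (graded_bracket p q X Y).
Proof.
move=> [lX gX dX] [lY gY dY].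
have [LX EX] := linear_fun lX; have [LY EY] := linear_fun lY.
rewrite /graded_bracket; split=> [a f g|r f fr|r f g fr].
- by rewrite lY lX lX lY scalerDr scalerBr opprD !scalerA (mulrC a) addrACA.
- apply: homogeneousD.
    by rewrite -addbA; exact: gX (gY _ _ fr).
  by apply/homogeneousN/homogeneousZ; rewrite (addbC p) -addbA; exact: gY (gX _ _ fr).
- rewrite (dY r) // (dX r) // EX EY !linearD !linearZ /= -EX -EY.
  rewrite (dX _ _ _ (gY _ _ fr)) (dX r) // (dY _ _ _ (gX _ _ fr)) (dY r) //.
  rewrite !(mulrDl, mulrDr, mulNr, mulrN, scalerN) -!(scalerAl, scalerAr) ?(mulNr, mulrN).
  super_lin; case: (p); case: (q); case: (r); rewrite /=; ring.
Qed.

End Superderivations.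

(** * The fields T_r and X_f *)

Section ContactFields.
Variables (R : realType) (l n : nat).
Local Notation m := (1 + (l + l))%N.
Local Notation superfun := (superfun R m n).
Local Notation N := (l + l + n)%N.
Local Notation t := (@Tparity l n).
Local Notation T := (@Tfield R l n).
Local Notation om := (@omega R l n).
Implicit Types (f g h : superfun) (p q : bool) (r s u v : 'I_N).

Lemma graded_der_d_even i : graded_der false (@d_even R m n i).
Proof.
split=> [|p f|p f g _]; [exact: linearP | exact: d_even_homogeneous |].
by rewrite scale1r; exact: d_evenM.
Qed.

Lemma graded_der_d_odd j : graded_der true (@d_odd R m n j).
Proof.
by split=> [|p f|p f g]; [exact: linearP | exact: d_odd_homogeneous | exact: d_oddM].
Qed.

(** With [cT], this writes T_r as a coordinate derivative plus a multiple of dz. Commutators of the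
    T_r are then computed uniformly, and the three index blocks are inspected only for [dT], [cT]
    and [omega]. *)
Definition dT r : superfun -> superfun :=
  match split r with
  | inl s => match split s with inl i => @dx R l n i | inr i => @dy R l n i end
  | inr j => @d_odd R m n j
  end.

Definition cT r : superfun :=
  match split r with
  | inl s => match split s with inl i => yvar R n i | inr i => - xvar R n i end
  | inr j => - theta R m j
  end.

Lemma TfieldE r f : T r f = dT r f + cT r * dz f.
Proof.
by rewrite /Tfield /dT /cT; case: split => [s|j]; [case: split => i|]; rewrite ?mulNr.
Qed.

Lemma split_lsh (a b : nat) (i : 'I_a) : split (lshift b i) = inl i.
Proof. exact: (unsplitK (inl i)). Qed.

Lemma split_rsh (a b : nat) (i : 'I_b) : split (rshift a i) = inr i.
Proof. exact: (unsplitK (inr i)). Qed.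

Variant index_spec : 'I_N -> Type :=
  | IndexX i : index_spec (lshift n (lshift l i))
  | IndexY i : index_spec (lshift n (rshift l i))
  | IndexTheta j : index_spec (rshift (l + l) j).

Lemma indexP r : index_spec r.
Proof.
have [s ->|j ->] := split_ordP r; last exact: IndexTheta.
by have [i ->|i ->] := split_ordP s; [exact: IndexX | exact: IndexY].
Qed.

Lemma Tparity_lshift (i : 'I_(l + l)) : t (lshift n i) = false.
Proof. by rewrite /Tparity /= leqNgt ltn_ord. Qed.

Lemma Tparity_rshift j : t (rshift (l + l) j) = true.
Proof. by rewrite /Tparity /= leq_addr. Qed.

(** Used in nearly every sign computation below: a term containing [om r s] either vanishes or
    allows [t r] and [t s] to be identified. *)
Lemma omega_parity r s : t r != t s -> om r s = 0.
Proof.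
rewrite /omega; have [r' ->|j ->] := split_ordP r; have [s' ->|k ->] := split_ordP s;
  rewrite ?Tparity_lshift ?Tparity_rshift // => _.
  by rewrite block_mxEur mxE.
by rewrite block_mxEdl mxE.
Qed.

Definition omegaE := (block_mxEul, block_mxEur, block_mxEdl, block_mxEdr).

(** Antisymmetry on the even block and symmetry on the odd block, in one formula. *)
Lemma omega_sym r s : om s r = - (-1) ^+ t r * om r s.
Proof.
rewrite /omega; case: (indexP r) => i; case: (indexP s) => j;
  rewrite ?Tparity_lshift ?Tparity_rshift !omegaE !mxE ?mulr0 //;
  by rewrite [j == i]eq_sym; case: (i == j); rewrite /=; ring.
Qed.

Lemma trmx_omega_mul : om^T *m om = 1%:M.
Proof.
rewrite /omega !tr_block_mx !trmx0 !linearN /= !trmx1.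
rewrite !mulmx_block !(mulmx0, mul0mx, addr0, add0r, mulNmx, mulmxN, mulmx1, opprK, oppr0).
by rewrite -!scalar_mx_block.
Qed.

Lemma omega_orth r s : \sum_v om v r * om v s = (r == s)%:R.
Proof.
have /matrixP/(_ r s) := trmx_omega_mul; rewrite !mxE => <-.
by apply: eq_bigr => v _; rewrite !mxE.
Qed.

Let d_evenN i f : d_even i (- f) = - d_even i f. Proof. exact: raddfN. Qed.
Let d_oddN i f : d_odd i (- f) = - d_odd i f. Proof. exact: raddfN. Qed.
Let nat_alg (b : bool) : b%:R = b%:R *: (1 : superfun).
Proof. by case: b; rewrite ?scale1r ?scale0r. Qed.

(** This is the origin of [omega]: up to sign, its entries are the constant derivatives of the
    dz-coefficients of the T_s. *)
Lemma dT_cT r s : dT r (cT s) = ((-1) ^+ t r * om r s) *: 1.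
Proof.
rewrite /omega /dT /cT.
case: (indexP r) => i; case: (indexP s) => j;
  rewrite ?Tparity_lshift ?Tparity_rshift !omegaE !mxE !(split_lsh, split_rsh).
all: rewrite ?(d_evenN, d_oddN) /dx /dy ?(d_evenN, d_oddN) /xvar /yvar
  ?(d_even_of_smooth, d_odd_of_smooth, d_even_theta, d_odd_theta)
  ?spartial_coord ?of_smooth_nat /ix /iy ?(eq_rshift, eq_lshift, eq_rlshift, eq_lrshift)
  ?(nat_alg (_ == _)) ?(expr0, expr1, mul1r, mulr0, scale0r, oppr0, mulN1r, scaleNr) //.
all: by rewrite [j == i]eq_sym.
Qed.

Lemma dz_dT r f : dz (dT r f) = dT r (dz f).
Proof.
rewrite /dT; case: split => [s|j]; last exact: d_even_odd.
by case: split => i; exact: d_even_comm.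
Qed.

Lemma dz_cT r : dz (cT r) = 0.
Proof.
rewrite /cT /dz /xvar /yvar; case: split => [s|j]; last first.
  by rewrite d_evenN d_even_theta oppr0.
case: split => i; rewrite ?d_evenN d_even_of_smooth spartial_coord /ix /iy /iz
  eq_rlshift of_smooth_nat ?oppr0 //.
Qed.

Lemma graded_der_dT r : graded_der (t r) (dT r).
Proof.
rewrite /dT; case: (indexP r) => i;
  rewrite ?(Tparity_lshift, Tparity_rshift) !(split_lsh, split_rsh).
- exact: graded_der_d_even.
- exact: graded_der_d_even.
- exact: graded_der_d_odd.
Qed.

Lemma cT_homogeneous r : homogeneous (t r) (cT r).
Proof.
rewrite /cT; case: (indexP r) => i;
  rewrite ?(Tparity_lshift, Tparity_rshift) !(split_lsh, split_rsh).
- exact: of_smooth_homogeneous.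
- exact/homogeneousN/of_smooth_homogeneous.
- exact/homogeneousN/theta_homogeneous.
Qed.

Lemma dT_comm r s f : dT r (dT s f) = (-1 : R) ^+ (t r && t s) *: dT s (dT r f).
Proof.
rewrite /dT; case: (indexP r) => i; case: (indexP s) => j;
  rewrite ?(Tparity_lshift, Tparity_rshift) !(split_lsh, split_rsh) ?scale1r ?scaleN1r;
  first [exact: d_even_comm | exact: d_even_odd | exact/esym/d_even_odd
        | exact: d_odd_anticomm].
Qed.

Lemma graded_der_dz : graded_der false (@dz R l n).
Proof. exact: graded_der_d_even. Qed.

Lemma dzD f g : dz (f + g) = dz f + dz g. Proof. exact: raddfD. Qed.
Lemma dzM f g : dz (f * g) = dz f * g + f * dz g. Proof. exact: d_evenM. Qed.

Lemma graded_der_Tfield r : graded_der (t r) (T r).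
Proof.
have -> : T r = dT r + (fun f => cT r * dz f) by apply/funext => f; exact: TfieldE.
apply: graded_derD; first exact: graded_der_dT.
by rewrite -[t r]addbF; apply: graded_der_mull graded_der_dz; exact: cT_homogeneous.
Qed.

Lemma dz_Tfield r f : dz (T r f) = T r (dz f).
Proof. by rewrite !TfieldE dzD dzM dz_cT mul0r add0r dz_dT. Qed.

(** The coordinate derivatives and the functions [cT] supercommute, and dz kills [cT], so only the
    derivatives of [cT s] along [dT r] and of [cT r] along [dT s] survive. By [omega_sym] they
    agree, whence the factor 2. *)
Lemma Tfield_comm r s f : T r (T s f) = (-1 : R) ^+ (t r && t s) *: T s (T r f)
  + (2 * (-1) ^+ t r * om r s) *: dz f.
Proof.
have [lr _ dr] := graded_der_dT r; have [ls _ ds] := graded_der_dT s.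
have Dr g h : dT r (g + h) = dT r g + dT r h by rewrite -[g]scale1r lr !scale1r.
have Ds g h : dT s (g + h) = dT s g + dT s h by rewrite -[g]scale1r ls !scale1r.
rewrite !TfieldE Dr Ds !dzD !dzM !dz_cT !mul0r !add0r.
rewrite (dr _ _ _ (cT_homogeneous s)) (ds _ _ _ (cT_homogeneous r)) !dT_cT.
rewrite dT_comm !dz_dT !mulrDr.
rewrite ![cT _ * (cT _ * _)]mulrA (supermulC (cT_homogeneous s) (cT_homogeneous r)).
rewrite !scale_mulr !mul1r (omega_sym r s).
have [E|/omega_parity ->] := eqVneq (t r) (t s).
  rewrite E; super_lin; case: (t s); rewrite /=; ring.
super_lin; case: (t s); case: (t r); rewrite /=; ring.
Qed.

End ContactFields.

(** * Commutators of X_f with T_r and dz; the bracket formula for homogeneous functions *)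

Section Hamiltonian.
Variables (R : realType) (l n : nat).
Local Notation m := (1 + (l + l))%N.
Local Notation superfun := (superfun R m n).
Local Notation N := (l + l + n)%N.
Local Notation t := (@Tparity l n).
Local Notation T := (@Tfield R l n).
Local Notation om := (@omega R l n).
Local Notation ham := (@hamiltonian_hom R l n).
Local Notation pb := (@poisson_hom R l n).
Implicit Types (f g h : superfun) (p q : bool) (r s u v : 'I_N).

Lemma Tfield_linear r : linear (T r).
Proof. by have [] := graded_der_Tfield R r. Qed.

Lemma dz_linear : linear (@dz R l n).
Proof. exact: linearP. Qed.

(* The coefficient of T_s in X_f. *)
Definition ham_coef p f s : superfun :=
  \sum_r (- 2^-1 * (-1) ^+ (p && t r) * om r s) *: T r f.

Lemma hamiltonian_homE p f h : ham p f h = f * dz h + \sum_s ham_coef p f s * T s h.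
Proof.
rewrite /hamiltonian_hom exchange_big; congr (_ + _).
rewrite -scaleNr scaler_sumr; apply: eq_bigr => s _.
rewrite mulr_suml scaler_sumr; apply: eq_bigr => r _.
by rewrite scale_mulr scalerA mulrA.
Qed.

Lemma poisson_homE p f g : pb p f g = ham p f g - dz f * g.
Proof.
rewrite /poisson_hom /hamiltonian_hom addrAC; congr (_ - _ - _).
by do 3!(congr (_ *: _) || (apply: eq_bigr => ? _)); rewrite andbC.
Qed.

Lemma ham_coef_homogeneous p f s : homogeneous p f ->
  homogeneous (p (+) t s) (ham_coef p f s).
Proof.
move=> fp; apply: homogeneous_sum => r _.
have [<-|/omega_parity ->] := eqVneq (t r) (t s); last first.
  by rewrite mulr0 scale0r; exact: homogeneous0.
by apply: homogeneousZ; rewrite addbC; have [_ gT _] := graded_der_Tfield R r; exact: gT.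
Qed.

Lemma graded_der_hamiltonian_hom p f : homogeneous p f -> graded_der p (ham p f).
Proof.
move=> fp.
have -> : ham p f = (fun h => f * dz h) + \sum_s (fun h => ham_coef p f s * T s h).
  apply/funext => h; rewrite hamiltonian_homE fctE; congr (_ + _).
  by elim/big_ind2: _ => //= x1 x2 y1 y2 -> ->.
apply: graded_derD.
  by rewrite -[p]addbF; apply: graded_der_mull fp (@graded_der_dz R l n).
apply: graded_der_sum => s; rewrite -[p](addbK (t s)).
apply: graded_der_mull (graded_der_Tfield R s); rewrite addbK.
exact: ham_coef_homogeneous.
Qed.

(* The dz-component of [T_r, X_f] vanishes. *)
Lemma Tfield_ham_coef p f r :
  T r f + \sum_s ((-1) ^+ (t r && (p (+) t s)) * (2 * (-1) ^+ t r * om r s))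
    *: ham_coef p f s = 0.
Proof.
under eq_bigr => s _ do rewrite scaler_sumr.
rewrite exchange_big /=.
(* The 2 of [Tfield_comm] meets the [- 2^-1] of [ham_coef]; transposing both entries of [om] absorbs
   the parity signs, and the inner sum is an entry of om^T om. *)
transitivity (T r f - \sum_u (\sum_s om s r * om s u) *: T u f).
  congr (_ + _); rewrite -sumrN; apply: eq_bigr => u _.
  rewrite scaler_suml -sumrN; apply: eq_bigr => s _.
  rewrite scalerA -scaleNr; congr (_ *: _); rewrite (omega_sym R r s) (omega_sym R s u).
  have [E|/omega_parity ->] := eqVneq (t r) (t s); last by rewrite !(mulr0, mul0r, oppr0).
  have [E'|/omega_parity ->] := eqVneq (t s) (t u); last by rewrite !(mulr0, mul0r, oppr0).
  by rewrite -E' E; case: (t s); case: (p); rewrite /=; field.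
rewrite (bigD1 r) //= omega_orth eqxx scale1r big1 ?addr0 ?subrr // => u ur.
by rewrite omega_orth eq_sym (negPf ur) scale0r.
Qed.

Lemma Tfield_hamiltonian p f r h : homogeneous p f ->
  T r (ham p f h) = (-1 : R) ^+ (t r && p) *: ham p f (T r h)
    + \sum_s T r (ham_coef p f s) * T s h.
Proof.
move=> fp; have [lT _ dT] := graded_der_Tfield R r.
rewrite !hamiltonian_homE (linear_add _ _ lT) (linear_sum _ _ lT) (dT _ _ _ fp).
have E s : T r (ham_coef p f s * T s h) =
    (-1 : R) ^+ (t r && p) *: (ham_coef p f s * T s (T r h))
    + (((-1) ^+ (t r && (p (+) t s)) * (2 * (-1) ^+ t r * om r s))
        *: ham_coef p f s) * dz h
    + T r (ham_coef p f s) * T s h.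
  rewrite (dT _ _ _ (ham_coef_homogeneous s fp)) Tfield_comm mulrDr !mul_scaler !scale_mulr.
  by super_lin; case: (t r); case: (t s); case: (p); rewrite /=; ring.
under eq_bigr => s _ do rewrite E.
rewrite !big_split /= -mulr_suml -scaler_sumr.
(* The collected coefficient of [dz h] is - T_r(f), which cancels the Leibniz term from
   [f * dz h]. *)
have /eqP := Tfield_ham_coef p f r; rewrite addrC addr_eq0 => /eqP ->.
rewrite dz_Tfield scalerDr mulNr.
by super_lin; ring.
Qed.

(** In view of [dz_ham_coef] this is [dz, X_f] = X_{f'}, left expanded so that coefficients of dz
    and of T_s can be compared. *)
Lemma dz_hamiltonian_hom p f h :
  dz (ham p f h) = ham p f (dz h) + (dz f * dz h + \sum_s dz (ham_coef p f s) * T s h).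
Proof.
rewrite !hamiltonian_homE dzD dzM (linear_sum _ _ dz_linear).
under eq_bigr => s _ do rewrite dzM dz_Tfield.
by rewrite big_split /=; super_lin; ring.
Qed.

Lemma dz_ham_coef p f s : dz (ham_coef p f s) = ham_coef p (dz f) s.
Proof.
rewrite /ham_coef (linear_sumZ _ _ _ dz_linear).
by apply: eq_bigr => r _; rewrite dz_Tfield.
Qed.

(* The second derivatives of f cancel up to [T_v, T_r], a multiple of dz. *)
Lemma ham_coef_poisson_term p q f g u r s v : homogeneous p f -> homogeneous q g ->
  (- 2^-1 * (-1) ^+ ((p (+) q) && t r) * om r u * (- 2^-1 * (-1) ^+ (p && t v) * om v s))
      *: (T r (T v f) * T s g)
  + (-1 : R) ^+ (p && q) *:
    ((- 2^-1 * (-1) ^+ (q && t s) * om s v * (- 2^-1 * (-1) ^+ (p && t r) * om r u))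
      *: (T s g * T v (T r f)))
  = (- 2^-1 * (-1) ^+ (q && t s) * om r u * (om v s * om v r)) *: (dz f * T s g).
Proof.
move=> fp gq; have [_ gTs _] := graded_der_Tfield R s.
have [_ gTr _] := graded_der_Tfield R r; have [_ gTv _] := graded_der_Tfield R v.
rewrite (supermulC (gTs _ _ gq) (gTv _ _ (gTr _ _ fp))) (Tfield_comm v r) mulrDl !scale_mulr.
rewrite (omega_sym R v s).
have [E|/omega_parity ->] := eqVneq (t v) (t s); last by super_lin; ring.
have [E'|/omega_parity ->] := eqVneq (t v) (t r); last first.
  super_lin; rewrite E.
  by case: (p); case: (q); case: (t r); case: (t s); rewrite /=; field.
by super_lin; rewrite -E' E; case: (p); case: (q); case: (t s); rewrite /=; field.
Qed.

(** Expand T_r(X_f(g) - f' g), with a and b the coefficients of X_f and X_g. [S1] is X_f(b_u) and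
    [S3] the dz-part of X_g(a_u); [S2] trades the second derivatives of f for the T-part of X_g(a_u)
    plus f' b_u, and [S4] removes f' b_u. *)
Lemma ham_coef_poisson p q f g u : homogeneous p f -> homogeneous q g ->
  ham_coef (p (+) q) (pb p f g) u =
  ham p f (ham_coef q g u) - (-1 : R) ^+ (p && q) *: ham q g (ham_coef p f u).
Proof.
move=> fp gq; have [lX _ _] := graded_der_hamiltonian_hom fp.
have [_ gz _] := graded_der_dz R l n.
(* The weight of T_r in the u-th coefficient for parity [p (+) q]; the sign from moving X_f or f'
   past T_r turns it into the weight for parity [q], which builds b_u. *)
pose k r := - 2^-1 * (-1) ^+ ((p (+) q) && t r) * om r u : R.
have S1 : \sum_r (k r * (-1) ^+ (t r && p)) *: ham p f (T r g) = ham p f (ham_coef q g u).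
  rewrite (linear_sumZ _ _ _ lX); apply: eq_bigr => r _; congr (_ *: _).
  by rewrite /k; case: (p); case: (q); case: (t r); rewrite /=; ring.
have S3 : \sum_r k r *: (T r (dz f) * g) =
    (-1 : R) ^+ (p && q) *: (g * dz (ham_coef p f u)).
  have gd := gz _ _ (ham_coef_homogeneous u fp).
  rewrite (supermulC gq gd) scalerA dz_ham_coef /ham_coef mulr_suml scaler_sumr.
  apply: eq_bigr => r _; rewrite scale_mulr scalerA; congr (_ *: _); rewrite /k.
  have [<-|/omega_parity ->] := eqVneq (t r) (t u); last by rewrite !mulr0.
  by case: (p); case: (q); case: (t r); rewrite /=; ring.
have S4 : \sum_r (k r * (-1) ^+ (t r && p)) *: (dz f * T r g) = dz f * ham_coef q g u.
  rewrite mulr_sumr; apply: eq_bigr => r _; rewrite mul_scaler; congr (_ *: _).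
  by rewrite /k; case: (p); case: (q); case: (t r); rewrite /=; ring.
have S2 : \sum_r k r *: (\sum_s T r (ham_coef p f s) * T s g)
    + (-1 : R) ^+ (p && q) *: (\sum_s ham_coef q g s * T s (ham_coef p f u)) =
    dz f * ham_coef q g u.
  transitivity (\sum_r \sum_s \sum_v (- 2^-1 * (-1) ^+ (q && t s) * om r u
      * (om v s * om v r)) *: (dz f * T s g)).
    (* The indices of the second triple sum are renamed so that [r] is still tied to [u] and [s]
       still differentiates g; T_r T_v f then faces T_v T_r f term by term. *)
    transitivity (\sum_r \sum_s \sum_v
        (k r * (- 2^-1 * (-1) ^+ (p && t v) * om v s)) *: (T r (T v f) * T s g)
      + \sum_r \sum_s \sum_v (-1 : R) ^+ (p && q) *:
        ((- 2^-1 * (-1) ^+ (q && t s) * om s v * (- 2^-1 * (-1) ^+ (p && t r) * om r u))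
          *: (T s g * T v (T r f)))).
      congr (_ + _).
        apply: eq_bigr => r _; rewrite scaler_sumr; apply: eq_bigr => s _.
        rewrite (linear_sumZ _ _ _ (@Tfield_linear r)) mulr_suml scaler_sumr.
        by apply: eq_bigr => v _; rewrite scale_mulr scalerA.
      rewrite [RHS]exchange_big scaler_sumr /=.
      under [RHS]eq_bigr => s _ do rewrite exchange_big.
      rewrite [RHS]exchange_big /=; apply: eq_bigr => v _.
      rewrite mulr_suml scaler_sumr; apply: eq_bigr => s _.
      rewrite (linear_sumZ _ _ _ (@Tfield_linear v)) mulr_sumr scaler_sumr.
      by apply: eq_bigr => r _; rewrite scale_mulr mul_scaler !scalerA !mulrA.
    rewrite -big_split; apply: eq_bigr => r _; rewrite -big_split; apply: eq_bigr => s _.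
    rewrite -big_split; apply: eq_bigr => v _; exact: ham_coef_poisson_term.
  (* Now [v] occurs only in [om v s * om v r], so summing over it forces r = s. *)
  rewrite exchange_big mulr_sumr; apply: eq_bigr => s _ /=.
  under eq_bigr => r _ do rewrite -scaler_suml -mulr_sumr omega_orth.
  rewrite (bigD1 s) //= eqxx mulr1 big1 ?addr0 ?mul_scaler // => r rs.
  by rewrite eq_sym (negPf rs) mulr0 scale0r.
rewrite [ham q g _]hamiltonian_homE scalerDr -S3 -S1.
move: S2 => /(canRL (addrK _)); rewrite -S4 => S2.
transitivity (\sum_r (k r * (-1) ^+ (t r && p)) *: ham p f (T r g)
  + \sum_r k r *: (\sum_s T r (ham_coef p f s) * T s g)
  - \sum_r k r *: (T r (dz f) * g)
  - \sum_r (k r * (-1) ^+ (t r && p)) *: (dz f * T r g)).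
  rewrite -!sumrN -!big_split /=; apply: eq_bigr => r _; rewrite -/(k r).
  have [lT _ dTr] := graded_der_Tfield R r.
  rewrite poisson_homE (linear_sub _ _ lT) Tfield_hamiltonian // (dTr _ _ _ (gz _ _ fp)).
  by super_lin; ring.
by rewrite S2; super_lin; ring.
Qed.

Lemma hamiltonian_hom_bracket p q f g : homogeneous p f -> homogeneous q g ->
  graded_bracket p q (ham p f) (ham q g) = ham (p (+) q) (pb p f g).
Proof.
move=> fp gq; apply/funext => h; rewrite /graded_bracket.
have [lf _ df] := graded_der_hamiltonian_hom fp.
(* The commutation rules are solved for X_f(T_s h) and X_f(dz h): X_f h then becomes the argument,
   and these terms reassemble X_g(X_f h), which the bracket subtracts. *)
have Tham s : ham p f (T s h) = (-1 : R) ^+ (t s && p) *: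
    (T s (ham p f h) - \sum_u T s (ham_coef p f u) * T u h).
  by rewrite Tfield_hamiltonian // addrK scalerA -signr_addb addbb scale1r.
have dzham : ham p f (dz h) = dz (ham p f h)
    - (dz f * dz h + \sum_u dz (ham_coef p f u) * T u h).
  by rewrite dz_hamiltonian_hom addrK.
rewrite [ham q g h]hamiltonian_homE (linear_add _ _ lf) (linear_sum _ _ lf) (df _ _ _ gq) dzham.
have E s : ham p f (ham_coef q g s * T s h) = ham p f (ham_coef q g s) * T s h
    + (-1 : R) ^+ (p && q) *: (ham_coef q g s * T s (ham p f h))
    - (-1 : R) ^+ (p && q) *: (\sum_u (ham_coef q g s * T s (ham_coef p f u)) * T u h).
  rewrite (df _ _ _ (ham_coef_homogeneous s gq)) Tham mul_scaler mulrBr.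
  under [X in _ - _ *: X]eq_bigr => u _ do rewrite -mulrA.
  rewrite -mulr_sumr.
  by super_lin; case: (p); case: (q); case: (t s); rewrite /=; ring.
rewrite (eq_bigr _ (fun s _ => E s)).
rewrite !big_split /= sumrN -!scaler_sumr exchange_big /=.
rewrite [ham q g (ham p f h)]hamiltonian_homE [RHS]hamiltonian_homE.
(* Splitting X_g(a_u) into its dz-part and T-part reproduces the two correction sums left by [dzham]
   and [Tham]. *)
have E' u : ham_coef (p (+) q) (pb p f g) u * T u h = ham p f (ham_coef q g u) * T u h
    - (-1 : R) ^+ (p && q) *: (g * (dz (ham_coef p f u) * T u h)
       + \sum_s (ham_coef q g s * T s (ham_coef p f u)) * T u h).
  rewrite ham_coef_poisson // mulrBl scale_mulr [ham q g _]hamiltonian_homE [X in _ - _ *: X]mulrDl.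
  by rewrite mulr_suml mulrA.
rewrite (eq_bigr _ (fun u _ => E' u)).
rewrite big_split /= sumrN -scaler_sumr big_split /= -mulr_sumr.
have [_ gz _] := graded_der_dz R l n.
have C : dz f * g = (-1 : R) ^+ (p && q) *: (g * dz f) := supermulC (gz _ _ fp) gq.
rewrite poisson_homE C; move: (ham p f g) (ham p f h) => A B.
rewrite mulrBl scale_mulr -!mulrA !(mulrBr, mulrDr).
by super_lin; ring.
Qed.

End Hamiltonian.

(** * Contact vector fields *)

Section Superbracket.
Variables (R : realType) (m n : nat).
Local Notation superfun := (superfun R m n).
Implicit Types (f g h : superfun) (p q r s : bool) (X Y Z : superfun -> superfun).

Lemma op_partD p X Y : op_part p (X + Y) = op_part p X + op_part p Y.
Proof.
apply/funext => f; rewrite -[RHS]/(op_part p X f + op_part p Y f) /op_part.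
rewrite -big_split /=; apply: eq_bigr => q _ /=.
exact: raddfD.
Qed.

Lemma op_partZ p (a : R) X : op_part p (a *: X) = a *: op_part p X.
Proof.
apply/funext => f; rewrite -[RHS]/(a *: op_part p X f) /op_part.
rewrite scaler_sumr; apply: eq_bigr => q _ /=.
exact: linearZ.
Qed.

Lemma op_part0 p : op_part p (0 : superfun -> superfun) = 0.
Proof. by apply/funext => f; rewrite /op_part big1 // => q _; exact: raddf0. Qed.

Lemma op_part_homogeneous p q X f : linear X -> homogeneous q f ->
  op_part p X f = parity_part (p (+) q) (X f).
Proof.
move=> /linear_fun[L ->] fq; rewrite /op_part (bigD1 q) //= big1.
  by rewrite addr0 fq.
by move=> r /negPf rq; rewrite (parity_part_homogeneous _ fq) rq !raddf0.
Qed.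

Lemma superbracketE X Y : superbracket X Y =
  \sum_(p : bool) \sum_(q : bool) graded_bracket p q (op_part p X) (op_part q Y).
Proof.
apply/funext => f; transitivity (\sum_(p : bool) \sum_(q : bool)
    graded_bracket p q (op_part p X) (op_part q Y) f); last by rewrite !big_bool.
by apply: eq_bigr => p _; apply: eq_bigr => q _; rewrite /graded_bracket signE.
Qed.

Lemma graded_bracket0r p q X : linear X -> graded_bracket p q X 0 = 0.
Proof.
move=> /linear_fun[L ->]; apply/funext => f.
by rewrite /graded_bracket raddf0 scaler0 subrr.
Qed.

Lemma superbracket_graded q X Y : linear X -> graded_der q Y -> superbracket X Y =
  \sum_(p : bool) graded_bracket p q (op_part p X) Y.
Proof.
move=> lX [lY gY _]; rewrite superbracketE; apply: eq_bigr => p _.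
rewrite (bigD1 q) //= big1 ?addr0 => [|r /negPf rq].
  by rewrite (op_part_of_graded _ lY gY) eqxx.
rewrite (op_part_of_graded _ lY gY) rq; apply: graded_bracket0r.
exact: op_part_linear.
Qed.

(** Against a homogeneous [Y], components of [X] of different parity give brackets of different
    parity, so each can be isolated. *)
Lemma op_part_superbracket p q X Y : superderivation X -> graded_der q Y ->
  op_part (p (+) q) (superbracket X Y) = graded_bracket p q (op_part p X) Y.
Proof.
move=> /superderivationP[lX dX] dY; rewrite (superbracket_graded lX dY).
have E r : op_part (p (+) q) (graded_bracket r q (op_part r X) Y) =
    if p == r then graded_bracket r q (op_part r X) Y else 0.
  have [lB gB _] := graded_der_bracket (dX r) dY.
  by rewrite (op_part_of_graded _ lB gB) (inj_eq (@addIb q)).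
by rewrite big_bool op_partD !E; case: (p) => /=; rewrite ?addr0 ?add0r.
Qed.

Lemma superderivation_lin (a : R) X Y : superderivation X -> superderivation Y ->
  superderivation (a *: X + Y).
Proof.
move=> /superderivationP[lX dX] /superderivationP[lY dY]; apply/superderivationP.
split=> [b f g|p]; last first.
  by rewrite op_partD op_partZ; apply/graded_derD => //; exact: graded_derZ.
by rewrite !fctE lX lY !scalerDr !scalerA [b * a]mulrC addrACA.
Qed.

Lemma graded_bracketDl p q X Y Z :
  linear Z ->
  graded_bracket p q (X + Y) Z = graded_bracket p q X Z + graded_bracket p q Y Z.
Proof.
move=> /linear_fun[L ->]; apply/funext => f; rewrite /graded_bracket !fctE raddfD.
by super_lin; ring.
Qed.

Lemma graded_bracketZl p q (a : R) X Z :
  linear Z -> graded_bracket p q (a *: X) Z = a *: graded_bracket p q X Z.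
Proof.
move=> /linear_fun[L ->]; apply/funext => f; rewrite /graded_bracket !fctE.
have -> : L (a *: X f) = a *: L (X f) by exact: linearZ.
by super_lin; ring.
Qed.

(** Arranged so that [Z] sits in both inner brackets: for [Z] tangent and [X], [Y] contact, the
    inner brackets are again tangent. *)
Lemma graded_jacobi p q s X Y Z : linear X -> linear Y -> linear Z ->
  graded_bracket (p (+) q) s (graded_bracket p q X Y) Z =
  graded_bracket p (q (+) s) X (graded_bracket q s Y Z)
  - (-1 : R) ^+ (p && q) *: graded_bracket q (p (+) s) Y (graded_bracket p s X Z).
Proof.
move=> /linear_fun[LX ->] /linear_fun[LY ->] /linear_fun[LZ ->].
apply/funext => f; rewrite /graded_bracket !fctE !linearB !linearZ /=.
by super_lin; case: p; case: q; case: s; rewrite /=; ring.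
Qed.

Lemma parity_part_mulr p q f g : homogeneous q g ->
  parity_part p (f * g) = parity_part (p (+) q) f * g.
Proof.
move=> gq; rewrite {1}[f]parity_part_sum big_bool mulrDl raddfD /=.
rewrite !(parity_part_homogeneous _ (homogeneousM (homogeneous_part _ f) gq)).
by case: p; case: q {gq}; rewrite /= ?addr0 ?add0r.
Qed.

Lemma parity_part_mull p f g : homogeneous false f ->
  parity_part p (f * g) = f * parity_part p g.
Proof.
move=> f0; rewrite {1}[g]parity_part_sum big_bool mulrDr raddfD /=.
rewrite !(parity_part_homogeneous _ (homogeneousM f0 (homogeneous_part _ g))).
by case: p; rewrite /= ?addr0 ?add0r.
Qed.

End Superbracket.

(** * The contact fields form a Lie superalgebra *)

Section ContactAlgebra.
Variables (R : realType) (l n : nat).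
Local Notation m := (1 + (l + l))%N.
Local Notation superfun := (superfun R m n).
Implicit Types (f g h : superfun) (p q r s : bool) (X Y T : superfun -> superfun).

Lemma alpha_lin (a : R) X Y : alpha (a *: X + Y) = a *: alpha X + alpha Y :> superfun.
Proof.
pose A X := \sum_(i < l) (xvar R n i * X (yvar R n i) - yvar R n i * X (xvar R n i)).
pose B X := \sum_(j < n) X (theta R m j) * theta R m j.
have EA : A (a *: X + Y) = a *: A X + A Y.
  rewrite /A scaler_sumr -big_split; apply: eq_bigr => i _; rewrite /= !fctE.
  by rewrite !mulrDr !mul_scaler; super_lin; ring.
have EB : B (a *: X + Y) = a *: B X + B Y.
  rewrite /B scaler_sumr -big_split; apply: eq_bigr => i _; rewrite /= !fctE.
  by rewrite mulrDl scale_mulr.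
have E Z : alpha Z = Z (zvar R l n) + A Z + B Z by [].
by rewrite !E EA EB -[(a *: X + Y) _]/(a *: X _ + Y _); super_lin; ring.
Qed.

Lemma alpha_lin0 (a : R) X Y : alpha X = 0 -> alpha Y = 0 -> alpha (a *: X + Y) = 0.
Proof. by move=> aX aY; rewrite alpha_lin aX aY scaler0 addr0. Qed.

(** The form [alpha] is even: evaluating [X] on theta_j shifts the parity by one, and the factor
    theta_j shifts it back. *)
Lemma alpha_op_part p X : linear X -> alpha (op_part p X) = parity_part p (alpha X).
Proof.
move=> lX; rewrite /alpha !raddfD /= !raddf_sum /=.
rewrite (op_part_homogeneous p lX (of_smooth_homogeneous _ _)) addbF.
congr (_ + _ + _); apply: eq_bigr => i _.
  rewrite !(op_part_homogeneous p lX (of_smooth_homogeneous _ _)) addbF raddfB /=.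
  by rewrite !parity_part_mull //; exact: of_smooth_homogeneous.
rewrite (op_part_homogeneous p lX (theta_homogeneous _ _ _)).
by rewrite (parity_part_mulr _ _ (theta_homogeneous _ _ _)).
Qed.

Lemma alpha0 : alpha (0 : superfun -> superfun) = 0.
Proof. by have := alpha_lin (-1) 0 0; rewrite scaler0 addr0 scaleN1r addNr. Qed.

Lemma Tan_lin (a : R) X Y : Tan X -> Tan Y -> Tan (a *: X + Y).
Proof.
move=> [vX aX] [vY aY]; split; [exact: superderivation_lin | exact: alpha_lin0].
Qed.

Lemma TanD X Y : Tan X -> Tan Y -> Tan (X + Y).
Proof. by move=> tX tY; rewrite -[X in X + Y]scale1r; exact: Tan_lin. Qed.

Definition graded_contact p X := graded_der p X /\
  forall q T, graded_der q T -> alpha T = 0 -> alpha (graded_bracket p q X T) = 0.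

Lemma graded_contact0 p : graded_contact p (0 : superfun -> superfun).
Proof.
split=> [|q T [lT _ _] _]; first exact: graded_der0.
have -> : graded_bracket p q 0 T = 0; last exact: alpha0.
apply/funext => f; have [L ->] := linear_fun lT.
by rewrite /graded_bracket raddf0 scaler0 subrr.
Qed.

Lemma graded_contact_lin p (a : R) X Y :
  graded_contact p X -> graded_contact p Y -> graded_contact p (a *: X + Y).
Proof.
move=> [dX cX] [dY cY]; split=> [|q T dT aT].
  by apply: graded_derD => //; exact: graded_derZ.
have [lT _ _] := dT.
by rewrite graded_bracketDl // graded_bracketZl // alpha_lin cX // cY // scaler0 addr0.
Qed.

Lemma graded_contact_bracket p q X Y : graded_contact p X -> graded_contact q Y ->
  graded_contact (p (+) q) (graded_bracket p q X Y).
Proof.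
move=> [dX cX] [dY cY]; split=> [|s T dT aT]; first exact: graded_der_bracket.
have [lX _ _] := dX; have [lY _ _] := dY; have [lT _ _] := dT.
have -> : graded_bracket (p (+) q) s (graded_bracket p q X Y) T =
    (- (-1 : R) ^+ (p && q)) *: graded_bracket q (p (+) s) Y (graded_bracket p s X T)
    + graded_bracket p (q (+) s) X (graded_bracket q s Y T).
  by rewrite graded_jacobi // addrC scaleNr.
apply: alpha_lin0.
  exact: cY (graded_der_bracket dX dT) (cX _ _ dT aT).
exact: cX (graded_der_bracket dY dT) (cY _ _ dT aT).
Qed.

(** Testing on homogeneous tangent fields suffices. Forwards, the bracket of a component of [X] with
    a homogeneous [T] is a component of [X, T], and [alpha] respects components; backwards, the
    components of a tangent [T] are tangent, and brackets are summed. *)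
Lemma contactP X :
  contact X <-> linear X /\ forall p, graded_contact p (op_part p X).
Proof.
split=> [[vX cX]|[lX cX]].
  have /superderivationP[lX dX] := vX; split=> // p; split=> // q T dT aT.
  have [] := cX T; first by split=> //; exact: graded_der_superderivation dT.
  move=> /superderivationP[lB _] aB.
  by rewrite -op_part_superbracket // alpha_op_part // aB raddf0.
have vX : superderivation X by apply/superderivationP; split=> // p; have [] := cX p.
split=> // T [/superderivationP[lT dT] aT].
rewrite superbracketE.
have cT p q : Tan (graded_bracket p q (op_part p X) (op_part q T)).
  have [dX bX] := cX p; split.
    exact: graded_der_superderivation (graded_der_bracket dX (dT q)).
  by apply: bX => //; rewrite alpha_op_part // aT raddf0.
by rewrite !big_bool; apply: TanD; apply: TanD; exact: cT.
Qed.

Lemma contact_lin (a : R) X Y : contact X -> contact Y -> contact (a *: X + Y).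
Proof.
move=> /contactP[lX cX] /contactP[lY cY]; apply/contactP; split=> [|p].
  move=> b f g; rewrite !fctE lX lY !scalerDr !scalerA [b * a]mulrC.
  by rewrite addrACA.
by rewrite op_partD op_partZ; exact: graded_contact_lin.
Qed.

Lemma contact0 : contact (0 : superfun -> superfun).
Proof.
apply/contactP; split=> [a f g|p]; first by rewrite scaler0 addr0.
by rewrite op_part0; exact: graded_contact0.
Qed.

Lemma contactD X Y : contact X -> contact Y -> contact (X + Y).
Proof. by move=> cX cY; rewrite -[X in X + Y]scale1r; exact: contact_lin. Qed.

Lemma graded_contact_contact p X : graded_contact p X -> contact X.
Proof.
move=> cX; have [[lX gX _] _] := cX; apply/contactP; split; first exact: lX.
move=> q; rewrite (op_part_of_graded _ lX gX); case: eqP => [->|_]; first exact: cX.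
exact: graded_contact0.
Qed.

Lemma contact_lie : lie_subsuperalgebra (@contact R l n).
Proof.
split.
- by move=> X [].
- exact: contact0.
- exact: contact_lin.
- by move=> p X /contactP[_ cX]; exact: graded_contact_contact (cX p).
- move=> X Y /contactP[lX cX] /contactP[lY cY]; rewrite superbracketE.
  have cB p q : contact (graded_bracket p q (op_part p X) (op_part q Y)).
    exact: graded_contact_contact (graded_contact_bracket (cX p) (cY q)).
  by rewrite !big_bool; apply: contactD; apply: contactD; exact: cB.
Qed.

End ContactAlgebra.

(** * From homogeneous to arbitrary superfunctions *)

Section HamiltonianBracket.
Variables (R : realType) (l n : nat).
Local Notation m := (1 + (l + l))%N.
Local Notation superfun := (superfun R m n).
Local Notation ham := (@hamiltonian_hom R l n).
Local Notation pb := (@poisson_hom R l n).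
Implicit Types (f g h : superfun) (p q r : bool).

Lemma hamiltonian_homD p f g : ham p (f + g) = ham p f + ham p g.
Proof.
apply/funext => h; rewrite fctE !hamiltonian_homE.
have E s : ham_coef p (f + g) s = ham_coef p f s + ham_coef p g s.
  rewrite /ham_coef -big_split; apply: eq_bigr => r _.
  by rewrite (linear_add _ _ (@Tfield_linear R l n r)) scalerDr.
under eq_bigr => s _ do rewrite E mulrDl.
by rewrite big_split mulrDl addrACA.
Qed.

Lemma hamiltonianE f : hamiltonian f = \sum_(p : bool) ham p (parity_part p f).
Proof. by apply/funext => h; rewrite /hamiltonian !big_bool. Qed.

Lemma hamiltonianD f g : hamiltonian (f + g) = hamiltonian f + hamiltonian g.
Proof. by rewrite !hamiltonianE -big_split; apply: eq_bigr => p _; rewrite raddfD hamiltonian_homD. Qed.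

Lemma hamiltonian_sum (F : bool -> superfun) :
  hamiltonian (\sum_(p : bool) F p) = \sum_(p : bool) hamiltonian (F p).
Proof. by rewrite !big_bool; exact: hamiltonianD. Qed.

Lemma hamiltonian_homogeneous p f : homogeneous p f -> hamiltonian f = ham p f.
Proof.
move=> fp; have ham0 q : ham q 0 = 0.
  by apply: (@addrI _ (ham q 0)); rewrite -hamiltonian_homD !addr0.
rewrite hamiltonianE (bigD1 p) //= big1 ?addr0 ?fp // => q /negPf qp.
by rewrite (parity_part_homogeneous _ fp) qp.
Qed.

Lemma op_part_hamiltonian p f : op_part p (hamiltonian f) = ham p (parity_part p f).
Proof.
have E q : op_part p (ham q (parity_part q f)) =
    if p == q then ham q (parity_part q f) else 0.
  have [lh gh _] := graded_der_hamiltonian_hom (homogeneous_part q f).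
  exact: op_part_of_graded.
rewrite hamiltonianE big_bool op_partD !E.
by case: (p); [exact: addr0 | exact: add0r].
Qed.

Lemma poisson_hom_homogeneous p q f g : homogeneous p f -> homogeneous q g ->
  homogeneous (p (+) q) (pb p f g).
Proof.
move=> fp gq; rewrite poisson_homE; have [_ gX _] := graded_der_hamiltonian_hom fp.
apply: homogeneousD; first exact: gX.
have [_ gz _] := graded_der_dz R l n.
by apply/homogeneousN/homogeneousM => //; exact: gz fp.
Qed.

(** The signs in [poisson] depend on the parity of [f] alone, so its definition splits only [f];
    splitting [g] as well, by linearity, matches the double sum in [superbracketE]. *)
Lemma poissonE f g : poisson f g =
  \sum_(p : bool) \sum_(q : bool) pb p (parity_part p f) (parity_part q g).
Proof.
apply: eq_bigr => p _; rewrite {1}[g]parity_part_sum !big_bool !poisson_homE.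
have [lX _ _] := graded_der_hamiltonian_hom (homogeneous_part p f).
by rewrite (linear_add _ _ lX) mulrDr opprD addrACA.
Qed.

Lemma hamiltonian_bracket f g :
  superbracket (hamiltonian f) (hamiltonian g) = hamiltonian (poisson f g).
Proof.
have E p q : hamiltonian (pb p (parity_part p f) (parity_part q g)) =
    graded_bracket p q (op_part p (hamiltonian f)) (op_part q (hamiltonian g)).
  have fp := homogeneous_part p f; have gq := homogeneous_part q g.
  by rewrite (hamiltonian_homogeneous (poisson_hom_homogeneous fp gq)) -hamiltonian_hom_bracket //
    !op_part_hamiltonian.
rewrite superbracketE poissonE hamiltonian_sum; apply: eq_bigr => p _.
by rewrite hamiltonian_sum; apply: eq_bigr => q _; rewrite E.
Qed.

End HamiltonianBracket.

Theorem proposition6p3 (R : realType) (l n : nat) (hn : (0 < n)%N) :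
  lie_subsuperalgebra (@contact R l n) /\
  (forall f g : superfun R (1 + (l + l)) n,
     superbracket (hamiltonian f) (hamiltonian g) = hamiltonian (poisson f g)).
Proof. by split; [exact: contact_lie | exact: hamiltonian_bracket]. Qed.
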